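(* Let $R$ be a commutative ring. The operad $\mathrm{Lie}$ over $R$, regarded as a non-symmetric operad in $R$-modules (by forgetting the actions of the symmetric groups), is a free non-symmetric operad; that is, there is a sequence $X=(X_n)_{n\ge 2}$ of $R$-modules such that $\mathrm{Lie}$ is isomorphic, as a non-symmetric operad in $R$-modules, to the free non-symmetric operad $F(X)$ generated by $X$ (with $X_n$ placed in arity $n$).
   Context: For $k\ge 1$, $\mathrm{Lie}(k)$ is the $R$-submodule of the free Lie algebra over $R$ on generators $x_1,\dots,x_k$ spanned by the iterated bracket words in which each generator appears exactly once. The unit of the operad is $x_1\in \mathrm{Lie}(1)$. The composition $\circ_i:\mathrm{Lie}(k)\otimes \mathrm{Lie}(l)\to \mathrm{Lie}(k+l-1)$ ($1\le i\le k$) is defined as follows: $A\circ_i B$ is obtained from $A$ by replacing each $x_j$ with $j>i$ by $x_{j+l-1}$, and replacing $x_i$ by the expression obtained from $B$ by shifting all its indices by $i-1$. Operads here are reduced with no generators in arity $0$ and $1$. The free non-symmetric operad $F(X)$ on a sequence $X=(X_n)_{n\ge 2}$ of $R$-modules is the non-symmetric operad in $R$-modules with maps $X_n\to F(X)(n)$ that is universal: any sequence of $R$-linear maps $X_n\to O(n)$, $n\ge 2$, to a non-symmetric operad $O$ in $R$-modules extends uniquely to a morphism of non-symmetric operads $F(X)\to O$. Explicitly, $F(X)(0)=0$, $F(X)(1)=R$ is spanned by the unit, and for $k>1$ $F(X)(k)$ is the direct sum, over planar rooted trees with $k$ leaves all of whose internal vertices have at least two inputs, of the tensor product over internal vertices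 $v$ of $X_{|v|}$, where $|v|$ is the number of inputs of $v$; composition is grafting of trees. *)

(* Defs.v *)
From HB Require Import structures.
From mathcomp Require Import all_boot all_order all_algebra.
From mathcomp Require Import boolp zify.

Set Implicit Arguments.
Unset Strict Implicit.
Unset Printing Implicit Defensive.

Import GRing.Theory.
Local Open Scope ring_scope.
Local Open Scope quotient_scope.

(* [comPzRingType] rather than [comNzRingType]: the zero ring is allowed.
   Inputs are numbered from 0, so [ns_comp _ i a b] is the partial composition
   usually written a \circ_(i+1) b.  Its arity m + n - 1 is given as any k with
   m + n = k.+1; this avoids transports between equal arities.  For the same
   reason the ordinals l, i', j' below, which live in the intermediate arities,
   are specified by their values. *)
Record nsOperad (R : comPzRingType) := NsOperad {
  ns_mod :> nat -> lmodType R;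
  ns_unit : ns_mod 1;
  ns_comp : forall m n k : nat, (m + n)%N = k.+1 ->
    'I_m -> ns_mod m -> ns_mod n -> ns_mod k;
  ns_comp_linearl : forall m n k (mnk : (m + n)%N = k.+1) (i : 'I_m) b,
    linear (fun a => ns_comp mnk i a b);
  ns_comp_linearr : forall m n k (mnk : (m + n)%N = k.+1) (i : 'I_m) a,
    linear (ns_comp mnk i a);
  ns_comp1l : forall n (e : (1 + n)%N = n.+1) (i : 'I_1) (b : ns_mod n),
    ns_comp e i ns_unit b = b;
  ns_comp1r : forall m (e : (m + 1)%N = m.+1) (i : 'I_m) (a : ns_mod m),
    ns_comp e i a ns_unit = a;
  ns_comp_seq : forall m n p k q r
    (mnk : (m + n)%N = k.+1) (kpr : (k + p)%N = r.+1)
    (npq : (n + p)%N = q.+1) (mqr : (m + q)%N = r.+1)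
    (i : 'I_m) (j : 'I_n) (l : 'I_k) a b c,
    l = (i + j)%N :> nat ->
    ns_comp kpr l (ns_comp mnk i a b) c = ns_comp mqr i a (ns_comp npq j b c);
  ns_comp_par : forall m n p k q r
    (mnk : (m + n)%N = k.+1) (kpr : (k + p)%N = r.+1)
    (mpq : (m + p)%N = q.+1) (qnr : (q + n)%N = r.+1)
    (i j : 'I_m) (j' : 'I_k) (i' : 'I_q) a b c,
    (i < j)%N -> j'.+1 = (j + n)%N :> nat -> i' = i :> nat ->
    ns_comp kpr j' (ns_comp mnk i a b) c = ns_comp qnr i' (ns_comp mpq j a c) b
}.

Record nsOperadHom (R : comPzRingType) (O P : nsOperad R) := NsOperadHom {
  ns_hom :> forall n, {linear O n -> P n};
  ns_hom_unit : ns_hom 1 (ns_unit O) = ns_unit P;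
  ns_hom_comp : forall m n k (mnk : (m + n)%N = k.+1) (i : 'I_m) a b,
    ns_hom k (ns_comp mnk i a b) = ns_comp mnk i (ns_hom m a) (ns_hom n b)
}.

Definition nsOperad_iso (R : comPzRingType) (O P : nsOperad R) : Prop :=
  exists (f : nsOperadHom O P) (g : nsOperadHom P O),
    forall n, cancel (f n) (g n) /\ cancel (g n) (f n).

(* [F], with the maps [iota], is the free non-symmetric operad on the modules
   X 2, X 3, ...; X 0 and X 1 are not used. *)
Definition is_free_nsOperad (R : comPzRingType) (X : nat -> lmodType R)
    (F : nsOperad R) (iota : forall n, {linear X n.+2 -> F n.+2}) : Prop :=
  forall (O : nsOperad R) (phi : forall n, {linear X n.+2 -> O n.+2}),
    exists f : nsOperadHom F O,
      (forall n x, f n.+2 (iota n x) = phi n x) /\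
      (forall g : nsOperadHom F O,
         (forall n x, g n.+2 (iota n x) = phi n x) ->
         forall n x, g n x = f n x).

Arguments is_free_nsOperad {R} X F iota.

Definition is_lie_bracket (R : comPzRingType) (L : lmodType R)
    (br : L -> L -> L) : Prop :=
  [/\ forall y, linear (br^~ y),
      forall x, linear (br x),
      forall x, br x x = 0 &
      forall x y z, br x (br y z) + br y (br z x) + br z (br x y) = 0].

Inductive lie_term (R T : Type) : Type :=
  | LGen of T
  | LZero
  | LAdd of lie_term R T & lie_term R T
  | LScale of R & lie_term R T
  | LBr of lie_term R T & lie_term R T.

Arguments LGen {R T}.
Arguments LZero {R T}.

HB.instance Definition _ (R T : Type) := gen_eqMixin (lie_term R T).
HB.instance Definition _ (R T : Type) := gen_choiceMixin (lie_term R T).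

Inductive lie_cong (R : comPzRingType) (T : Type) :
    lie_term R T -> lie_term R T -> Prop :=
  | lc_refl t : lie_cong t t
  | lc_sym t u : lie_cong t u -> lie_cong u t
  | lc_trans t u v : lie_cong t u -> lie_cong u v -> lie_cong t v
  | lc_add t t' u u' : lie_cong t t' -> lie_cong u u' ->
      lie_cong (LAdd t u) (LAdd t' u')
  | lc_scale a t t' : lie_cong t t' -> lie_cong (LScale a t) (LScale a t')
  | lc_br t t' u u' : lie_cong t t' -> lie_cong u u' ->
      lie_cong (LBr t u) (LBr t' u')
  | lc_addA t u v : lie_cong (LAdd t (LAdd u v)) (LAdd (LAdd t u) v)
  | lc_addC t u : lie_cong (LAdd t u) (LAdd u t)
  | lc_add0 t : lie_cong (LAdd LZero t) t
  | lc_addN t : lie_cong (LAdd (LScale (-1) t) t) LZero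
  | lc_scaleA a b t : lie_cong (LScale a (LScale b t)) (LScale (a * b) t)
  | lc_scale1 t : lie_cong (LScale 1 t) t
  | lc_scaleDr a t u :
      lie_cong (LScale a (LAdd t u)) (LAdd (LScale a t) (LScale a u))
  | lc_scaleDl a b t :
      lie_cong (LScale (a + b) t) (LAdd (LScale a t) (LScale b t))
  | lc_brDl t u v : lie_cong (LBr (LAdd t u) v) (LAdd (LBr t v) (LBr u v))
  | lc_brZl a t u : lie_cong (LBr (LScale a t) u) (LScale a (LBr t u))
  | lc_brDr t u v : lie_cong (LBr t (LAdd u v)) (LAdd (LBr t u) (LBr t v))
  | lc_brZr a t u : lie_cong (LBr t (LScale a u)) (LScale a (LBr t u))
  | lc_alt t : lie_cong (LBr t t) LZero
  | lc_jacobi t u v :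
      lie_cong (LAdd (LAdd (LBr t (LBr u v)) (LBr u (LBr v t)))
                     (LBr v (LBr t u))) LZero.

Section FreeLie.
Variables (R : comPzRingType) (T : Type).
Implicit Types t u v : lie_term R T.

Definition lie_congb t u : bool := `[< lie_cong t u >].

Lemma lie_congb_refl : reflexive lie_congb.
Proof. by move=> t; apply/asboolP; exact: lc_refl. Qed.

Lemma lie_congb_sym : symmetric lie_congb.
Proof. by move=> t u; apply/asboolP/asboolP; exact: lc_sym. Qed.

Lemma lie_congb_trans : transitive lie_congb.
Proof.
by move=> u t v /asboolP tu /asboolP uv; apply/asboolP; exact: lc_trans tu uv.
Qed.

Canonical lie_equiv :=
  EquivRel lie_congb lie_congb_refl lie_congb_sym lie_congb_trans.

(* The free Lie algebra over R on the set T of generators; its universal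
   property is [flie_lift_gen], [flie_lift_linear], [flie_lift_br] and
   [flie_lift_unique] below. *)
Definition flie : Type := {eq_quot lie_equiv}.

HB.instance Definition _ := Choice.on flie.
HB.instance Definition _ := Quotient.on flie.

Lemma flie_eqP t u : lie_cong t u <-> \pi_flie t = \pi_flie u.
Proof.
split; first by move=> tu; apply/eqmodP/asboolP.
by move/eqmodP/asboolP.
Qed.

Lemma flie_repr t : lie_cong (repr (\pi_flie t)) t.
Proof. by apply/flie_eqP; rewrite reprK. Qed.

Lemma flieW (P : flie -> Prop) : (forall t, P (\pi_flie t)) -> forall x, P x.
Proof. by move=> Ppi x; rewrite -[x]reprK; exact: Ppi. Qed.

Definition flie_gen (x : T) : flie := \pi_flie (LGen x).
Definition flie_zero : flie := \pi_flie LZero.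
Definition flie_add (x y : flie) : flie := \pi_flie (LAdd (repr x) (repr y)).
Definition flie_scale (a : R) (x : flie) : flie := \pi_flie (LScale a (repr x)).
Definition flie_opp (x : flie) : flie := flie_scale (-1) x.
Definition flie_br (x y : flie) : flie := \pi_flie (LBr (repr x) (repr y)).

Lemma flie_add_pi t u : flie_add (\pi_flie t) (\pi_flie u) = \pi_flie (LAdd t u).
Proof. by apply/flie_eqP; apply: lc_add; apply: flie_repr. Qed.

Lemma flie_scale_pi a t : flie_scale a (\pi_flie t) = \pi_flie (LScale a t).
Proof. by apply/flie_eqP; apply: lc_scale; apply: flie_repr. Qed.

Lemma flie_br_pi t u : flie_br (\pi_flie t) (\pi_flie u) = \pi_flie (LBr t u).
Proof. by apply/flie_eqP; apply: lc_br; apply: flie_repr. Qed.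

Lemma flie_addA : associative flie_add.
Proof.
elim/flieW => t; elim/flieW => u; elim/flieW => v.
by rewrite !flie_add_pi; apply/flie_eqP; exact: lc_addA.
Qed.

Lemma flie_addC : commutative flie_add.
Proof.
by elim/flieW => t; elim/flieW => u;
  rewrite !flie_add_pi; apply/flie_eqP; exact: lc_addC.
Qed.

Lemma flie_add0 : left_id flie_zero flie_add.
Proof. by elim/flieW => t; rewrite flie_add_pi; apply/flie_eqP; exact: lc_add0. Qed.

Lemma flie_addN : left_inverse flie_zero flie_opp flie_add.
Proof.
elim/flieW => t; rewrite /flie_opp flie_scale_pi flie_add_pi.
by apply/flie_eqP; exact: lc_addN.
Qed.

HB.instance Definition _ :=
  GRing.isZmodule.Build flie flie_addA flie_addC flie_add0 flie_addN.

Lemma flie_scaleA a b (x : flie) :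
  flie_scale a (flie_scale b x) = flie_scale (a * b) x.
Proof.
by elim/flieW: x => t; rewrite !flie_scale_pi; apply/flie_eqP; exact: lc_scaleA.
Qed.

Lemma flie_scale1 : left_id 1 flie_scale.
Proof.
by elim/flieW => t; rewrite flie_scale_pi; apply/flie_eqP; exact: lc_scale1.
Qed.

Lemma flie_scaleDr : right_distributive flie_scale +%R.
Proof.
move=> a; elim/flieW => t; elim/flieW => u; rewrite /GRing.add /=.
rewrite !(flie_scale_pi, flie_add_pi).
by apply/flie_eqP; exact: lc_scaleDr.
Qed.

Lemma flie_scaleDl x : {morph flie_scale^~ x : a b / a + b}.
Proof.
elim/flieW: x => t a b /=; rewrite [RHS]/GRing.add /=.
rewrite !flie_scale_pi flie_add_pi.
by apply/flie_eqP; exact: lc_scaleDl.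
Qed.

HB.instance Definition _ := GRing.Zmodule_isLmodule.Build R flie
  flie_scaleA flie_scale1 flie_scaleDr flie_scaleDl.

Lemma flie_piD t u : \pi_flie (LAdd t u) = \pi_flie t + \pi_flie u.
Proof. by rewrite -flie_add_pi. Qed.

Lemma flie_piZ a t : \pi_flie (LScale a t) = a *: \pi_flie t.
Proof. by rewrite -flie_scale_pi. Qed.

Lemma flie_pi0 : \pi_flie LZero = 0.
Proof. by []. Qed.

Lemma flie_br_lie : is_lie_bracket flie_br.
Proof.
split.
- move=> z a x y; elim/flieW: x => t; elim/flieW: y => u; elim/flieW: z => v.
  rewrite -flie_piZ -flie_piD !flie_br_pi -flie_piZ -flie_piD.
  apply/flie_eqP; apply: lc_trans (lc_brDl _ _ _) _.
  by apply: lc_add; [exact: lc_brZl | exact: lc_refl].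
- move=> z a x y; elim/flieW: x => t; elim/flieW: y => u; elim/flieW: z => v.
  rewrite -flie_piZ -flie_piD !flie_br_pi -flie_piZ -flie_piD.
  apply/flie_eqP; apply: lc_trans (lc_brDr _ _ _) _.
  by apply: lc_add; [exact: lc_brZr | exact: lc_refl].
- elim/flieW => t; rewrite flie_br_pi -flie_pi0.
  by apply/flie_eqP; exact: lc_alt.
- elim/flieW => t; elim/flieW => u; elim/flieW => v.
  rewrite !flie_br_pi.
  by have /flie_eqP := lc_jacobi t u v; rewrite !flie_piD.
Qed.

Section Lift.
Variables (L : lmodType R) (br : L -> L -> L) (f : T -> L).

Fixpoint lie_eval t : L :=
  match t with
  | LGen x => f x
  | LZero => 0
  | LAdd t u => lie_eval t + lie_eval u
  | LScale a t => a *: lie_eval t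
  | LBr t u => br (lie_eval t) (lie_eval u)
  end.

Definition flie_lift (x : flie) : L := lie_eval (repr x).

Hypothesis brP : is_lie_bracket br.

Lemma lie_eval_cong t u : lie_cong t u -> lie_eval t = lie_eval u.
Proof.
have [linl linr alt jac] := brP.
have brDl x y z : br (x + y) z = br x z + br y z.
  by have := linl z 1 x y; rewrite !scale1r.
have brDr x y z : br z (x + y) = br z x + br z y.
  by have := linr z 1 x y; rewrite !scale1r.
have br0l z : br 0 z = 0.
  by apply: (@addrI _ (br 0 z)); rewrite -brDl !addr0.
have br0r z : br z 0 = 0.
  by apply: (@addrI _ (br z 0)); rewrite -brDr !addr0.
have brZl a x z : br (a *: x) z = a *: br x z.
  by have := linl z a x 0; rewrite !addr0 br0l addr0.
have brZr a x z : br z (a *: x) = a *: br z x.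
  by have := linr z a x 0; rewrite !addr0 br0r addr0.
elim=> //=; clear -brDl brDr brZl brZr alt jac.
- by move=> t u v _ -> _ ->.
- by move=> t t' u u' _ -> _ ->.
- by move=> a t t' _ ->.
- by move=> t t' u u' _ -> _ ->.
- by move=> t u v; rewrite addrA.
- by move=> t u; rewrite addrC.
- by move=> t; rewrite add0r.
- by move=> t; rewrite scaleN1r addNr.
- by move=> a b t; rewrite scalerA.
- by move=> t; rewrite scale1r.
- by move=> a t u; rewrite scalerDr.
- by move=> a b t; rewrite scalerDl.
Qed.

Lemma flie_lift_pi t : flie_lift (\pi_flie t) = lie_eval t.
Proof. by apply: lie_eval_cong; exact: flie_repr. Qed.

Lemma flie_lift_gen x : flie_lift (flie_gen x) = f x.
Proof. by rewrite flie_lift_pi. Qed.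

Lemma flie_lift_linear : linear flie_lift.
Proof.
move=> a x y; elim/flieW: x => t; elim/flieW: y => u.
by rewrite -flie_piZ -flie_piD !flie_lift_pi.
Qed.

Lemma flie_lift_br x y : flie_lift (flie_br x y) = br (flie_lift x) (flie_lift y).
Proof.
by elim/flieW: x => t; elim/flieW: y => u; rewrite flie_br_pi !flie_lift_pi.
Qed.

Lemma flie_lift_unique (g : flie -> L) : linear g ->
  (forall x y, g (flie_br x y) = br (g x) (g y)) ->
  (forall x, g (flie_gen x) = f x) -> g =1 flie_lift.
Proof.
move=> glin gbr ggen; elim/flieW => t; rewrite flie_lift_pi.
have gD x y : g (x + y) = g x + g y.
  by have := glin 1 x y; rewrite !scale1r.
have g0 : g 0 = 0 by apply: (@addrI _ (g 0)); rewrite -gD !addr0.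
have gZ a x : g (a *: x) = a *: g x.
  by have := glin a x 0; rewrite !addr0 g0 addr0.
elim: t => //=.
- by move=> t IHt u IHu; rewrite flie_piD gD IHt IHu.
- by move=> a t IHt; rewrite flie_piZ gZ IHt.
- by move=> t IHt u IHu; rewrite -flie_br_pi gbr IHt IHu.
Qed.

End Lift.

End FreeLie.

Arguments flie_gen {R T}.

Section FreeLieSubst.
Variables (R : comPzRingType) (T U : Type) (f : T -> flie R U).

Definition flie_subst : flie R T -> flie R U := flie_lift (@flie_br R U) f.

Lemma flie_subst_linear : linear flie_subst.
Proof. exact: (flie_lift_linear _ (@flie_br_lie R U)). Qed.

HB.instance Definition _ :=
  GRing.isLinear.Build R (flie R T) (flie R U) _ flie_subst flie_subst_linear.

Lemma flie_subst_gen x : flie_subst (flie_gen x) = f x.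
Proof. exact: (flie_lift_gen _ (@flie_br_lie R U)). Qed.

Lemma flie_subst_br x y :
  flie_subst (flie_br x y) = flie_br (flie_subst x) (flie_subst y).
Proof. exact: (flie_lift_br _ (@flie_br_lie R U)). Qed.

Lemma flie_subst_unique (g : flie R T -> flie R U) : linear g ->
  (forall x y, g (flie_br x y) = flie_br (g x) (g y)) ->
  (forall x, g (flie_gen x) = f x) -> g =1 flie_subst.
Proof. exact: (flie_lift_unique (@flie_br_lie R U)). Qed.

End FreeLieSubst.

Lemma eq_flie_subst (R : comPzRingType) (T U : Type) (f g : T -> flie R U) :
  f =1 g -> flie_subst f =1 flie_subst g.
Proof. by move=> fg x; have -> : f = g by exact: funext. Qed.

Lemma flie_subst_comp (R : comPzRingType) (T U V : Type)
    (f : T -> flie R U) (g : U -> flie R V) (x : flie R T) :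
  flie_subst g (flie_subst f x) = flie_subst (fun t => flie_subst g (f t)) x.
Proof.
apply: (flie_subst_unique (g := flie_subst g \o flie_subst f)).
- by move=> a y z /=; rewrite !linearP.
- by move=> y z /=; rewrite !flie_subst_br.
- by move=> t /=; rewrite flie_subst_gen.
Qed.

Lemma flie_subst_id (R : comPzRingType) (T : Type) (x : flie R T) :
  flie_subst flie_gen x = x.
Proof. by apply/esym/(flie_subst_unique (g := id)). Qed.

Lemma flie_brDl (R : comPzRingType) (T : Type) (x y z : flie R T) a :
  flie_br (a *: x + y) z = a *: flie_br x z + flie_br y z.
Proof. by have [+ _ _ _] := @flie_br_lie R T; apply. Qed.

Lemma flie_brDr (R : comPzRingType) (T : Type) (x y z : flie R T) a :
  flie_br z (a *: x + y) = a *: flie_br z x + flie_br z y.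
Proof. by have [_ + _ _] := @flie_br_lie R T; apply. Qed.

Inductive lie_word (T : Type) : Type :=
  | WGen of T
  | WBr of lie_word T & lie_word T.

HB.instance Definition _ (T : Type) := gen_eqMixin (lie_word T).
HB.instance Definition _ (T : Type) := gen_choiceMixin (lie_word T).

Fixpoint lie_word_gens (T : Type) (w : lie_word T) : seq T :=
  match w with
  | WGen x => [:: x]
  | WBr u v => lie_word_gens u ++ lie_word_gens v
  end.

Fixpoint flie_word (R : comPzRingType) (T : Type) (w : lie_word T) : flie R T :=
  match w with
  | WGen x => flie_gen x
  | WBr u v => flie_br (flie_word R u) (flie_word R v)
  end.

(* Each of the generators indexed by 'I_k occurs exactly once in w. *)
Definition multilinear_word (k : nat) (w : lie_word 'I_k) : bool :=
  perm_eq (lie_word_gens w) (enum 'I_k).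

Definition lie_span (R : comPzRingType) (k : nat) : pred (flie R 'I_k) :=
  fun x => `[< exists2 s : seq (R * lie_word 'I_k),
    all (fun p => multilinear_word p.2) s &
    x = \sum_(p <- s) p.1 *: flie_word R p.2 >].

Lemma lie_span_submod (R : comPzRingType) k : submod_closed (@lie_span R k).
Proof.
split; first by apply/asboolP; exists [::]; rewrite ?big_nil.
move=> a x y /asboolP[s sm ->] /asboolP[s' sm' ->]; apply/asboolP.
exists ([seq (a * p.1, p.2) | p <- s] ++ s').
  by rewrite all_cat all_map sm' andbT.
rewrite big_cat big_map /= scaler_sumr; congr (_ + _).
by apply: eq_bigr => p _; rewrite scalerA.
Qed.

HB.instance Definition _ (R : comPzRingType) k :=
  GRing.isSubmodClosed.Build R (flie R 'I_k) (@lie_span R k)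
    (lie_span_submod R k).

Record lieMod (R : comPzRingType) (k : nat) := LieMod {
  lie_val :> flie R 'I_k;
  lie_valP : lie_val \in @lie_span R k
}.

HB.instance Definition _ (R : comPzRingType) k :=
  [isSub for @lie_val R k].
HB.instance Definition _ (R : comPzRingType) k :=
  [Choice of lieMod R k by <:].
HB.instance Definition _ (R : comPzRingType) k :=
  [SubChoice_isSubLmodule of lieMod R k by <:].

(* The generator number a of the free Lie algebra on k generators.  The value 0
   for a >= k is never used by [lie_circ] when m + n = k.+1. *)
Definition flie_x (R : comPzRingType) (k a : nat) : flie R 'I_k :=
  if insub a is Some o then flie_gen o else 0.

Definition lie_shift (R : comPzRingType) (n k : nat) (i : nat)
    (B : flie R 'I_n) : flie R 'I_k :=
  flie_subst (fun l : 'I_n => flie_x R k (l + i)%N) B.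

(* Partial composition, for k = m + n - 1; i and the indices of the generators
   start at 0. *)
Definition lie_circ (R : comPzRingType) (m n k : nat) (i : 'I_m)
    (A : flie R 'I_m) (B : flie R 'I_n) : flie R 'I_k :=
  flie_subst (fun j : 'I_m =>
    if (j < i)%N then flie_x R k j
    else if (i < j)%N then flie_x R k (j + n).-1%N
    else lie_shift k i B) A.

Section LieCircLemmas.
Variable R : comPzRingType.

Lemma flie_xE k (o : 'I_k) : flie_x R k o = flie_gen o.
Proof. by rewrite /flie_x valK. Qed.

Lemma flie_subst_x T k a (g : 'I_k -> flie R T) (ak : (a < k)%N) :
  flie_subst g (flie_x R k a) = g (Ordinal ak).
Proof. by rewrite (flie_xE (Ordinal ak)) flie_subst_gen. Qed.

Lemma lie_shift_x n k i a : (a < n)%N ->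
  lie_shift k i (flie_x R n a) = flie_x R k (a + i)%N.
Proof. by move=> an; rewrite /lie_shift (flie_subst_x _ an). Qed.

Lemma lie_circ_xl m n k (i : 'I_m) a (B : flie R 'I_n) : (a < i)%N ->
  lie_circ k i (flie_x R m a) B = flie_x R k a.
Proof.
move=> ai; have am : (a < m)%N by apply: ltn_trans ai _.
by rewrite /lie_circ (flie_subst_x _ am) /= ai.
Qed.

Lemma lie_circ_xr m n k (i : 'I_m) a (B : flie R 'I_n) : (i < a < m)%N ->
  lie_circ k i (flie_x R m a) B = flie_x R k (a + n).-1%N.
Proof.
case/andP=> ia am.
by rewrite /lie_circ (flie_subst_x _ am) /= ia ltnNge ltnW.
Qed.

Lemma lie_circ_xi m n k (i : 'I_m) a (B : flie R 'I_n) : a = i :> nat ->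
  lie_circ k i (flie_x R m a) B = lie_shift k i B.
Proof.
move=> ->; rewrite /lie_circ (flie_subst_x _ (ltn_ord i)) /=.
by rewrite !ltnn.
Qed.

Lemma lie_circ_subst T m n k (i : 'I_m) (h : T -> flie R 'I_m) A
    (C : flie R 'I_n) :
  lie_circ k i (flie_subst h A) C =
  flie_subst (fun t => lie_circ k i (h t) C) A.
Proof. exact: flie_subst_comp. Qed.

Lemma lie_shift_subst T n k i (h : T -> flie R 'I_n) A :
  lie_shift k i (flie_subst h A) = flie_subst (fun t => lie_shift k i (h t)) A.
Proof. exact: flie_subst_comp. Qed.

Lemma lie_circ_shift m n p k q r (i : 'I_m) (j : 'I_n) (l : 'I_k)
    (B : flie R 'I_n) (C : flie R 'I_p) :
  (m + n)%N = k.+1 -> (n + p)%N = q.+1 -> (k + p)%N = r.+1 ->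
  l = (i + j)%N :> nat ->
  lie_circ r l (lie_shift k i B) C = lie_shift r i (lie_circ q j B C).
Proof.
move=> mnk npq kpr lij.
rewrite [LHS]lie_circ_subst [RHS]lie_shift_subst.
apply: eq_flie_subst => t.
have := ltn_ord t; have := ltn_ord i; have := ltn_ord j => ltj lti ltt.
case: (ltngtP t j) => tj.
- rewrite lie_circ_xl ?lie_shift_x //; lia.
- rewrite lie_circ_xr ?lie_shift_x; try lia.
  by congr flie_x; lia.
- rewrite lie_circ_xi; last lia.
  rewrite [RHS]lie_shift_subst; apply: eq_flie_subst => u.
  have := ltn_ord u => ltu.
  by rewrite lie_shift_x; [congr flie_x | ]; lia.
Qed.

Lemma lie_circ_shift_lt m n p k r (i j : 'I_m) (l : 'I_k)
    (B : flie R 'I_n) (C : flie R 'I_p) :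
  (m + n)%N = k.+1 -> (k + p)%N = r.+1 -> (i < j)%N ->
  l.+1 = (j + n)%N :> nat ->
  lie_circ r l (lie_shift k i B) C = lie_shift r i B.
Proof.
move=> mnk kpr ij lj; rewrite [LHS]lie_circ_subst.
apply: eq_flie_subst => t; have := ltn_ord t => ltt.
by rewrite lie_circ_xl //; lia.
Qed.

Lemma lie_circ_shift_gt m n p k r (i j : 'I_m) (l : 'I_k)
    (B : flie R 'I_n) (C : flie R 'I_p) :
  (m + p)%N = k.+1 -> (k + n)%N = r.+1 -> (i < j)%N ->
  l = i :> nat ->
  lie_circ r l (lie_shift k j C) B = lie_shift r (j + n).-1 C.
Proof.
move=> mnk kpr ij lj; rewrite [LHS]lie_circ_subst.
apply: eq_flie_subst => t; have := ltn_ord t; have := ltn_ord j => ltj ltt.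
rewrite lie_circ_xr; last lia.
by congr flie_x; lia.
Qed.

Lemma lie_circ_seq m n p k q r (i : 'I_m) (j : 'I_n) (l : 'I_k)
    (A : flie R 'I_m) (B : flie R 'I_n) (C : flie R 'I_p) :
  (m + n)%N = k.+1 -> (k + p)%N = r.+1 -> (n + p)%N = q.+1 ->
  l = (i + j)%N :> nat ->
  lie_circ r l (lie_circ k i A B) C = lie_circ r i A (lie_circ q j B C).
Proof.
move=> mnk kpr npq lij.
rewrite [LHS]lie_circ_subst; apply: eq_flie_subst => t.
have := ltn_ord t; have := ltn_ord i; have := ltn_ord j => ltj lti ltt.
case: (ltngtP t i) => ti.
- by rewrite lie_circ_xl //; lia.
- rewrite lie_circ_xr; last lia.
  by congr flie_x; lia.
- exact: lie_circ_shift lij.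
Qed.

Lemma lie_circ_par m n p k q r (i j : 'I_m) (j' : 'I_k) (i' : 'I_q)
    (A : flie R 'I_m) (B : flie R 'I_n) (C : flie R 'I_p) :
  (m + n)%N = k.+1 -> (k + p)%N = r.+1 ->
  (m + p)%N = q.+1 -> (q + n)%N = r.+1 ->
  (i < j)%N -> j'.+1 = (j + n)%N :> nat -> i' = i :> nat ->
  lie_circ r j' (lie_circ k i A B) C = lie_circ r i' (lie_circ q j A C) B.
Proof.
move=> mnk kpr mpq qnr ij jj ii.
rewrite [LHS]lie_circ_subst [RHS]lie_circ_subst; apply: eq_flie_subst => t.
have := ltn_ord t; have := ltn_ord i; have := ltn_ord j => ltj lti ltt.
case: (ltngtP t i) => ti.
- have -> : (t < j)%N by lia.
  by rewrite !lie_circ_xl //; lia.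
- case: (ltngtP t j) => tj.
  + rewrite lie_circ_xl; last lia.
    rewrite lie_circ_xr; last lia.
    by congr flie_x; lia.
  + rewrite !lie_circ_xr; try lia.
    by congr flie_x; lia.
  + rewrite lie_circ_xi; last lia.
    rewrite (lie_circ_shift_gt _ _ mpq qnr ij ii).
    by congr lie_shift; lia.
- have -> : (t < j)%N by lia.
  rewrite (lie_circ_shift_lt _ _ mnk kpr ij jj).
  by rewrite lie_circ_xi ?ii //; lia.
Qed.

Lemma lie_circ1l n (i : 'I_1) (B : flie R 'I_n) :
  lie_circ n i (flie_gen ord0) B = B.
Proof.
rewrite -flie_xE lie_circ_xi ?(ord1 i) // /lie_shift.
rewrite -[RHS]flie_subst_id; apply: eq_flie_subst => t.
by rewrite addn0 flie_xE.
Qed.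

Lemma lie_circ1r m (i : 'I_m) (A : flie R 'I_m) :
  lie_circ m i A (flie_gen (ord0 : 'I_1)) = A.
Proof.
rewrite -[RHS]flie_subst_id; apply: eq_flie_subst => t.
case: (ltngtP t i) => ti.
- by rewrite flie_xE.
- by rewrite addn1 flie_xE.
- by rewrite -flie_xE lie_shift_x // add0n -ti flie_xE.
Qed.

Lemma lie_circ_linearl m n k (i : 'I_m) (B : flie R 'I_n) :
  linear (fun A => lie_circ k i A B).
Proof. exact: flie_subst_linear. Qed.

Lemma lie_circ_br m n k (i : 'I_m) (A A' : flie R 'I_m) (B : flie R 'I_n) :
  lie_circ k i (flie_br A A') B = flie_br (lie_circ k i A B) (lie_circ k i A' B).
Proof. exact: flie_subst_br. Qed.

Lemma lie_circ_word0 m n k (i : 'I_m) (w : lie_word 'I_m)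
    (B B' : flie R 'I_n) :
  i \notin lie_word_gens w ->
  lie_circ k i (flie_word R w) B = lie_circ k i (flie_word R w) B'.
Proof.
elim: w => [j | u IHu v IHv] /=.
  rewrite inE => ij; rewrite /lie_circ !flie_subst_gen.
  by case: ltngtP => // /val_inj ji; rewrite ji eqxx in ij.
by rewrite mem_cat negb_or !lie_circ_br => /andP[/IHu-> /IHv->].
Qed.

Lemma lie_circ_word_linear m n k (i : 'I_m) (w : lie_word 'I_m) :
  count_mem i (lie_word_gens w) = 1%N ->
  linear (fun B : flie R 'I_n => lie_circ k i (flie_word R w) B).
Proof.
elim: w => [j | u IHu v IHv] /=.
  case: eqP => // -> _ a B B'; rewrite -flie_xE !lie_circ_xi //.
  exact: flie_subst_linear.
rewrite count_cat => uv a B B'; rewrite !lie_circ_br.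
case cu: (count_mem i (lie_word_gens u)) uv => [|[|c]] // cv.
  have iu := introT count_memPn cu.
  rewrite (IHv cv) flie_brDr (lie_circ_word0 k (a *: B + B') B iu).
  by rewrite (lie_circ_word0 k B' B iu).
case: cv => cv; have iv := introT count_memPn cv.
rewrite (IHu cu) flie_brDl (lie_circ_word0 k (a *: B + B') B iv).
by rewrite (lie_circ_word0 k B' B iv).
Qed.

Lemma multilinear_count m (w : lie_word 'I_m) i :
  multilinear_word w -> count_mem i (lie_word_gens w) = 1%N.
Proof.
by move=> /permP->; rewrite count_uniq_mem ?enum_uniq // mem_enum.
Qed.

Lemma lie_circ_suml m n k (i : 'I_m) (s : seq (R * lie_word 'I_m))
    (B : flie R 'I_n) :
  lie_circ k i (\sum_(p <- s) p.1 *: flie_word R p.2) B =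
  \sum_(p <- s) p.1 *: lie_circ k i (flie_word R p.2) B.
Proof.
rewrite /lie_circ linear_sum; apply: eq_bigr => p _; exact: linearZ.
Qed.

Lemma lie_circ_linearr m n k (i : 'I_m) A :
  A \in @lie_span R m -> linear (fun B : flie R 'I_n => lie_circ k i A B).
Proof.
move=> /asboolP[s /allP sm ->] a B B'; rewrite !lie_circ_suml scaler_sumr.
rewrite -big_split /= big_seq [RHS]big_seq; apply: eq_bigr => p ps.
rewrite (lie_circ_word_linear k (multilinear_count i (sm p ps))).
by rewrite scalerDr !scalerA mulrC.
Qed.

Fixpoint lie_word_subst T U (f : T -> lie_word U) (w : lie_word T) :
    lie_word U :=
  match w with
  | WGen x => f x
  | WBr u v => WBr (lie_word_subst f u) (lie_word_subst f v)
  end.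

Lemma lie_word_gens_subst T U (f : T -> lie_word U) w :
  lie_word_gens (lie_word_subst f w) =
  flatten [seq lie_word_gens (f x) | x <- lie_word_gens w].
Proof.
elim: w => [x | u IHu v IHv] /=; first by rewrite cats0.
by rewrite map_cat flatten_cat IHu IHv.
Qed.

Lemma flie_word_subst T U (f : T -> lie_word U) w :
  flie_word R (lie_word_subst f w) =
  flie_subst (fun x => flie_word R (f x)) (flie_word R w).
Proof.
elim: w => [x | u IHu v IHv] /=; first by rewrite flie_subst_gen.
by rewrite flie_subst_br IHu IHv.
Qed.

Lemma lie_circ_word m n k (i : 'I_m) w v : (m + n)%N = k.+1 ->
  @multilinear_word m w -> @multilinear_word n v ->
  exists2 u : lie_word 'I_k, multilinear_word u &
    lie_circ k i (flie_word R w) (flie_word R v) = flie_word R u.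
Proof.
move=> mnk mw mv.
have n0 : (0 < n)%N.
  have ex u : exists l : 'I_n, l \in lie_word_gens u.
    elim: u => [l | u [l lu] u' _]; exists l; first by rewrite inE.
    by rewrite /= mem_cat lu.
  by have [l _] := ex v; exact: leq_ltn_trans (ltn_ord l).
case: k mnk => [|k] mnk; first by have := ltn_ord i; lia.
pose sh := lie_word_subst (fun l : 'I_n => WGen (inord (l + i) : 'I_k.+1)) v.
pose f (j : 'I_m) : lie_word 'I_k.+1 :=
  if (j < i)%N then WGen (inord j)
  else if (i < j)%N then WGen (inord (j + n).-1) else sh.
have inE' a : (a < k.+1)%N -> flie_gen (inord a : 'I_k.+1) = flie_x R k.+1 a.
  by move=> ak; rewrite -flie_xE inordK.
exists (lie_word_subst f w); last first.
  rewrite flie_word_subst; apply: eq_flie_subst => j; rewrite /f.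
  have := ltn_ord j; have := ltn_ord i => lti ltj.
  case: (ltngtP j i) => ji /=.
  - by rewrite inE' //; lia.
  - by rewrite inE' //; lia.
  - rewrite flie_word_subst; apply: eq_flie_subst => l /=.
    by rewrite inE' //; have := ltn_ord l; lia.
rewrite /multilinear_word lie_word_gens_subst.
set s := flatten _.
have sub : {subset enum 'I_k.+1 <= s}.
  move=> o _; apply/flatten_mapP; have := ltn_ord i; have := ltn_ord o => lto lti.
  have memw (j : 'I_m) : j \in lie_word_gens w.
    by rewrite (perm_mem mw) mem_enum.
  case: (ltnP o i) => oi.
    have om : (o < m)%N by lia.
    exists (Ordinal om); rewrite // /f /= oi /= inE -val_eqE /= inordK //; lia.
  case: (ltnP o (i + n)) => oin.
    exists i; rewrite // /f !ltnn lie_word_gens_subst; apply/flatten_mapP.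
    have on : (o - i < n)%N by lia.
    exists (Ordinal on); first by rewrite (perm_mem mv) mem_enum.
    by rewrite /= inE -val_eqE /= subnK // inordK.
  have om : (o - n.-1 < m)%N by lia.
  exists (Ordinal om); rewrite // /f /=.
  have -> : (o - n.-1 < i)%N = false by lia.
  have -> : (i < o - n.-1)%N by lia.
  have -> : (o - n.-1 + n).-1 = o by lia.
  by rewrite /= inE inord_val.
have sz : size s = k.+1.
  rewrite size_flatten sumnE /shape -map_comp big_map.
  rewrite (perm_big _ mw) big_enum /= (bigD1 i) //=.
  rewrite {1}/f !ltnn lie_word_gens_subst.
  rewrite size_flatten sumnE /shape -map_comp big_map /= sum1_size.
  rewrite (perm_size mv) size_enum_ord.
  rewrite (eq_bigr (fun => 1%N)); last first.
    move=> j; rewrite -val_eqE /= /f; case: ltngtP => //.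
  rewrite sum1_card cardC1 card_ord; have := ltn_ord i; lia.
have us : uniq s.
  by apply: leq_size_uniq sub _; rewrite ?enum_uniq // sz size_enum_ord.
apply: uniq_perm; rewrite ?enum_uniq // => o.
by rewrite mem_enum; apply: sub; rewrite mem_enum.
Qed.

Lemma lie_circ_span m n k (i : 'I_m) A B : (m + n)%N = k.+1 ->
  A \in @lie_span R m -> B \in @lie_span R n -> lie_circ k i A B \in @lie_span R k.
Proof.
move=> mnk Am /asboolP[t /allP tm ->].
pose L : {linear flie R 'I_n -> flie R 'I_k} :=
  HB.pack (lie_circ k i A)
    (GRing.isLinear.Build _ _ _ _ _ (lie_circ_linearr k i Am)).
rewrite (_ : lie_circ k i A _ = L (\sum_(p <- t) p.1 *: flie_word R p.2)) //.
rewrite linear_sum big_seq; apply: rpred_sum => q qt.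
rewrite linearZ; apply: rpredZ; rewrite /= {L}.
case/asboolP: Am => s /allP sm ->; rewrite lie_circ_suml big_seq.
apply: rpred_sum => p ps; apply: rpredZ.
have [u um ->] := lie_circ_word i mnk (sm p ps) (tm q qt).
apply/asboolP; exists [:: (1, u)]; first by rewrite /= um.
by rewrite big_seq1 scale1r.
Qed.

Lemma lie_gen_span : flie_gen ord0 \in @lie_span R 1.
Proof.
apply/asboolP; exists [:: (1, WGen ord0)]; last by rewrite big_seq1 scale1r.
by rewrite /= /multilinear_word /= andbT; apply/eqP; rewrite enum_ordSl enum_ord0.
Qed.

End LieCircLemmas.

Section LieOperad.
Variable R : comPzRingType.

Definition lie_unit : lieMod R 1 := LieMod (lie_gen_span R).

Definition lie_comp m n k (mnk : (m + n)%N = k.+1) (i : 'I_m)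
    (A : lieMod R m) (B : lieMod R n) : lieMod R k :=
  LieMod (lie_circ_span i mnk (lie_valP A) (lie_valP B)).

Lemma lie_comp_linearl m n k (mnk : (m + n)%N = k.+1) (i : 'I_m) B :
  linear (fun A => @lie_comp m n k mnk i A B).
Proof. by move=> a A A'; apply: val_inj; exact: lie_circ_linearl. Qed.

Lemma lie_comp_linearr m n k (mnk : (m + n)%N = k.+1) (i : 'I_m) A :
  linear (@lie_comp m n k mnk i A).
Proof.
move=> a B B'; apply: val_inj.
exact: (lie_circ_linearr k i (lie_valP A)).
Qed.

Lemma lie_comp1l n (e : (1 + n)%N = n.+1) (i : 'I_1) B :
  lie_comp e i lie_unit B = B.
Proof. by apply: val_inj; exact: lie_circ1l. Qed.

Lemma lie_comp1r m (e : (m + 1)%N = m.+1) (i : 'I_m) A :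
  lie_comp e i A lie_unit = A.
Proof. by apply: val_inj; exact: lie_circ1r. Qed.

Lemma lie_comp_seq m n p k q r
    (mnk : (m + n)%N = k.+1) (kpr : (k + p)%N = r.+1)
    (npq : (n + p)%N = q.+1) (mqr : (m + q)%N = r.+1)
    (i : 'I_m) (j : 'I_n) (l : 'I_k) A B C :
  l = (i + j)%N :> nat ->
  lie_comp kpr l (lie_comp mnk i A B) C = lie_comp mqr i A (lie_comp npq j B C).
Proof. by move=> lij; apply: val_inj; exact: lie_circ_seq. Qed.

Lemma lie_comp_par m n p k q r
    (mnk : (m + n)%N = k.+1) (kpr : (k + p)%N = r.+1)
    (mpq : (m + p)%N = q.+1) (qnr : (q + n)%N = r.+1)
    (i j : 'I_m) (j' : 'I_k) (i' : 'I_q) A B C :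
  (i < j)%N -> j'.+1 = (j + n)%N :> nat -> i' = i :> nat ->
  lie_comp kpr j' (lie_comp mnk i A B) C =
  lie_comp qnr i' (lie_comp mpq j A C) B.
Proof. by move=> ij jj ii; apply: val_inj; exact: lie_circ_par. Qed.

Definition Lie : nsOperad R :=
  @NsOperad R (fun k => lieMod R k : lmodType R) lie_unit lie_comp
    lie_comp_linearl lie_comp_linearr lie_comp1l lie_comp1r
    lie_comp_seq lie_comp_par.

End LieOperad.

(* Main.v *)
From HB Require Import structures.
Require Import Defs.
From mathcomp Require Import all_boot all_algebra.
From mathcomp Require Import boolp functions zify ring.

(** Why Lie is free.  Consider binary trees whose leaves carry distinct numbers and
    in which, at every vertex, the smallest label of the subtree lies on the left
    and the largest on the right.  Two facts about them give the theorem.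

    They form bases: the trees labelled bijectively by 0, ..., n-1 are a basis of
    Lie(n).  They span because [[A1, A2], B] = [[A1, B], A2] + [A1, [A2, B]] repairs a
    bracket of two such trees in which the minimum and the maximum are both in A
    ([straighten]).  They are independent because of a leading word: a tree
    [u, v] gets the word that starts with the leading word of u read from its
    minimum and goes on with the leading word of v read from its maximum.  Its
    coefficient in the expansion of the tree as an associative polynomial is a sign,
    and among the other trees it occurs only in smaller ones, for a well-founded order
    that compares the sizes of the branches first ([coefw_lead_triangular], [trees_free]).

    They are closed under partial composition, since replacing a label by an interval
    of labels preserves the comparison of minima and of maxima.  So Lie is the
    linearisation of a set operad of trees.  In it, t is the composite of s and u at
    i exactly when t has a subtree, a copy of u, whose labels form an interval
    starting at i; s is t with this block collapsed ([occ_circ], [contr_circ]).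
    Two blocks of a tree are nested or disjoint ([splits_cases]), because subtrees
    are; in the first case the two factorisations are related by sequential
    associativity, in the second by parallel associativity ([splits_nested],
    [splits_disjoint]).  Hence factorisations into indecomposable trees are unique up
    to the axioms of operads: the set operad is free on the indecomposable trees.

    Concretely, the generators in arity n are the span of the indecomposable trees,
    inside Lie(n).  Given linear maps from these spans to an operad O, a tree is
    evaluated in O by factoring it at any block; independence of the chosen
    block is the diamond argument above ([split_val_eq], [tree_val_comp]), and the
    basis property turns the evaluation into linear maps ([lie_gen_extend]). *)

Set Implicit Arguments.
Unset Strict Implicit.
Unset Printing Implicit Defensive.

Import GRing.Theory.

(** * Trees with minima on the left and maxima on the right *)

Local Open Scope ring_scope.

Notation tree := (lie_word nat).
Notation labels := (@lie_word_gens nat).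

Fixpoint minlab (t : tree) : nat :=
  match t with WGen a => a | WBr u v => minn (minlab u) (minlab v) end.

Fixpoint maxlab (t : tree) : nat :=
  match t with WGen a => a | WBr u v => maxn (maxlab u) (maxlab v) end.

Fixpoint minmax (t : tree) : bool :=
  match t with
  | WGen _ => true
  | WBr u v => [&& minmax u, minmax v, minlab u < minlab v & maxlab u < maxlab v]%N
  end.

Lemma labels_gt0 t : (0 < size (labels t))%N.
Proof. by elim: t => //= u IHu v IHv; rewrite size_cat; lia. Qed.

Lemma minlab_in t : minlab t \in labels t.
Proof.
elim: t => [a|u IHu v IHv] /=; first exact: mem_head.
by rewrite mem_cat /minn; case: ifP; rewrite ?IHu ?IHv ?orbT.
Qed.

Lemma maxlab_in t : maxlab t \in labels t.
Proof.
elim: t => [a|u IHu v IHv] /=; first exact: mem_head.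
by rewrite mem_cat /maxn; case: ifP; rewrite ?IHu ?IHv ?orbT.
Qed.

Lemma minlab_le t a : a \in labels t -> (minlab t <= a)%N.
Proof.
elim: t => [b|u IHu v IHv] /=; first by rewrite inE => /eqP->.
by rewrite mem_cat geq_min => /orP[/IHu->|/IHv->]; rewrite ?orbT.
Qed.

Lemma maxlab_ge t a : a \in labels t -> (a <= maxlab t)%N.
Proof.
elim: t => [b|u IHu v IHv] /=; first by rewrite inE => /eqP->.
by rewrite mem_cat leq_max => /orP[/IHu->|/IHv->]; rewrite ?orbT.
Qed.

Section Span.
Variables (R : comPzRingType) (V : lmodType R).

(** Linear combinations as an inductive predicate, so that bilinearity arguments
    are inductions instead of manipulations of double sums. *)
Inductive lspan (P : V -> Prop) : V -> Prop :=
  | span0 : lspan P 0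
  | spanS a x y : P x -> lspan P y -> lspan P (a *: x + y).

Lemma span_in (P : V -> Prop) x : P x -> lspan P x.
Proof. by move=> Px; rewrite -[x]addr0 -[x]scale1r; apply: spanS (span0 P). Qed.

Lemma spanD P x y : lspan P x -> lspan P y -> lspan P (x + y).
Proof.
by elim=> [|a u v Pu _ IH] Py; rewrite ?add0r // -addrA; apply: spanS (IH Py).
Qed.

Lemma spanZ P a x : lspan P x -> lspan P (a *: x).
Proof.
elim=> [|b u v Pu _ IH]; first by rewrite scaler0; apply: span0.
by rewrite scalerDr scalerA; apply: spanS.
Qed.

Lemma spanN P x : lspan P x -> lspan P (- x).
Proof. by rewrite -scaleN1r; apply: spanZ. Qed.

Lemma span_sub (P Q : V -> Prop) x :
  (forall y, P y -> lspan Q y) -> lspan P x -> lspan Q x.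
Proof.
move=> PQ; elim=> [|a u v Pu _ IH]; first exact: span0.
by apply: spanD => //; apply/spanZ/PQ.
Qed.

End Span.

Section LieBracket.
Variables (R : comPzRingType) (L : lmodType R) (br : L -> L -> L).
Hypothesis brP : is_lie_bracket br.

Lemma brDl x y z : br (x + y) z = br x z + br y z.
Proof. by have [+ _ _ _] := brP => /(_ z 1 x y); rewrite !scale1r. Qed.
Lemma brDr x y z : br z (x + y) = br z x + br z y.
Proof. by have [_ + _ _] := brP => /(_ z 1 x y); rewrite !scale1r. Qed.
Lemma br0l z : br 0 z = 0.
Proof. by apply: (@addrI _ (br 0 z)); rewrite -brDl !addr0. Qed.
Lemma br0r z : br z 0 = 0.
Proof. by apply: (@addrI _ (br z 0)); rewrite -brDr !addr0. Qed.
Lemma brxx x : br x x = 0.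
Proof. by have [_ _ + _] := brP; apply. Qed.
Lemma brC x y : br x y = - br y x.
Proof.
apply/eqP; rewrite -addr_eq0; apply/eqP.
by have := brxx (x + y); rewrite brDl !brDr !brxx add0r addr0.
Qed.
Lemma brNr x y : br x (- y) = - br x y.
Proof. by apply/eqP; rewrite -addr_eq0 -brDr addNr br0r. Qed.
(** The form of the Jacobi identity used for straightening: bracketing with z on the
    right is a derivation. *)
Lemma br_leibniz x y z : br (br x y) z = br (br x z) y + br x (br y z).
Proof.
have [_ _ _ /(_ x y z) jac] := brP.
rewrite (brC (br x y)) (brC (br x z)) (brC x z) brNr opprK addrC.
by apply/esym/eqP; rewrite -addr_eq0 jac.
Qed.

Lemma span_br (P Q S : L -> Prop) x y :
  (forall u v, P u -> Q v -> lspan S (br u v)) ->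
  lspan P x -> lspan Q y -> lspan S (br x y).
Proof.
move=> PQS; elim=> [|a u v Pu _ IH] Qy; first by rewrite br0l; exact: span0.
have [lin_l lin_r _ _] := brP; rewrite lin_l; apply: spanD (IH Qy).
apply: spanZ; elim: Qy => [|b u' v' Pu' _ IH']; first by rewrite br0r; exact: span0.
by rewrite lin_r; apply: spanD IH'; apply/spanZ/PQS.
Qed.

Variable gen : nat -> L.

Fixpoint treeval (t : tree) : L :=
  match t with WGen a => gen a | WBr u v => br (treeval u) (treeval v) end.

Definition minmax_on (s : seq nat) (x : L) : Prop :=
  exists2 t : tree, minmax t && perm_eq (labels t) s & x = treeval t.

(** Induction on the number of leaves.  By antisymmetry the minimum is in A.  If the
    maximum is in A = [A1, A2] as well, it is in A2 while the minimum is in A1; in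
    [[A1, B], A2] + [A1, [A2, B]] the inner brackets are smaller, and whatever trees
    they expand into, the outer bracket has its minimum on the left and its maximum
    on the right. *)
Lemma straighten (A B : tree) : minmax A -> minmax B ->
  uniq (labels A ++ labels B) ->
  lspan (minmax_on (labels A ++ labels B)) (br (treeval A) (treeval B)).
Proof.
have [n] := ubnP (size (labels A ++ labels B)).
elim: n => // n IHn in A B *.
wlog minAB : A B / (minlab A < minlab B)%N => [wl|] sz gA gB uAB.
  have uBA : uniq (labels B ++ labels A) by rewrite uniq_catC.
  have neq : minlab A != minlab B.
    apply/eqP => e; move: uAB; rewrite cat_uniq => /and3P[_ /hasPn/(_ (minlab B))].
    by rewrite minlab_in -e /= minlab_in => /(_ isT).
  have [|geq] := ltnP (minlab A) (minlab B); first by move=> h; exact: wl.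
  have lt : (minlab B < minlab A)%N by rewrite ltn_neqAle eq_sym neq.
  rewrite brC; apply: spanN.
  apply: span_sub (wl B A lt _ gB gA uBA); last first.
    by move: sz; rewrite !size_cat addnC.
  move=> _ [t /andP[gt pt] ->]; apply: span_in; exists t => //.
  by rewrite gt /= (perm_trans pt) // perm_catC.
have [maxAB|maxBA] := ltnP (maxlab A) (maxlab B).
  by apply: span_in; exists (WBr A B); rewrite //= gA gB minAB maxAB /=.
have disj a : a \in labels A -> a \in labels B -> False.
  move: uAB; rewrite cat_uniq => /and3P[_ /hasPn h _] aA aB.
  by have := h a aB; rewrite /= aA.
have neq : maxlab A != maxlab B.
  by apply/eqP => e; apply: (disj (maxlab A)); rewrite ?maxlab_in // e maxlab_in.
have {neq maxBA} maxBA : (maxlab B < maxlab A)%N by rewrite ltn_neqAle eq_sym neq.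
case: A => [a|A1 A2] in sz gA uAB minAB maxBA disj *.
  have := minlab_le (maxlab_in B); move: minAB maxBA => /=; lia.
move: gA => /= /and4P[gA1 gA2 min12 max12].
have [sz1 sz2] := (labels_gt0 A1, labels_gt0 A2).
have szB := labels_gt0 B.
move: sz; rewrite /= !size_cat => sz.
have [u1 u2] : uniq (labels A1 ++ labels B) /\ uniq (labels A2 ++ labels B).
  move: uAB; rewrite /= !cat_uniq => /and3P[/and3P[-> _ ->] h ->].
  rewrite !andbT /=; split; apply: contra h => /hasP[x xB xA];
    by apply/hasP; exists x => //=; rewrite mem_cat xA ?orbT.
have mA : minlab (WBr A1 A2) = minlab A1 by rewrite /=; apply/minn_idPl; lia.
have MA : maxlab (WBr A1 A2) = maxlab A2 by rewrite /=; apply/maxn_idPr; lia.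
rewrite mA in minAB; rewrite MA in maxBA.
rewrite br_leibniz; apply: spanD.
- have sp : lspan (minmax_on (labels A1 ++ labels B)) (br (treeval A1) (treeval B)).
    by apply: IHn => //; rewrite size_cat; lia.
  apply: span_br sp (span_in (P := eq (treeval A2)) erefl).
  move=> _ _ [C /andP[gC pC] ->] <-.
  apply: span_in; exists (WBr C A2); last by [].
  rewrite /= gC gA2 /=; apply/andP; split; last first.
    by rewrite perm_sym perm_catAC perm_sym perm_cat2r.
  have : minlab A1 \in labels C by rewrite (perm_mem pC) mem_cat minlab_in.
  have := maxlab_in C; rewrite (perm_mem pC) mem_cat.
  move=> /orP[] /maxlab_ge ? /minlab_le ?; lia.
- have sp : lspan (minmax_on (labels A2 ++ labels B)) (br (treeval A2) (treeval B)).
    by apply: IHn => //; rewrite size_cat; lia.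
  apply: span_br (span_in (P := eq (treeval A1)) erefl) sp.
  move=> _ _ <- [C /andP[gC pC] ->].
  apply: span_in; exists (WBr A1 C); last by [].
  rewrite /= gC gA1 /=; apply/andP; split; last by rewrite -catA perm_cat2l.
  have : maxlab A2 \in labels C by rewrite (perm_mem pC) mem_cat maxlab_in.
  have := minlab_in C; rewrite (perm_mem pC) mem_cat.
  move=> /orP[] /minlab_le ? /maxlab_ge ?; rewrite ?gA2 /=; lia.
Qed.

Lemma treeval_span (w : tree) :
  uniq (labels w) -> lspan (minmax_on (labels w)) (treeval w).
Proof.
elim: w => [a|u IHu v IHv] uw; first by
  apply: span_in; exists (WGen a); rewrite ?perm_refl.
have := uw; rewrite /= cat_uniq => /and3P[uu _ uv].
apply: span_br (IHu uu) (IHv uv) => _ _ [A /andP[gA pA] ->] [B /andP[gB pB] ->].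
have pAB : perm_eq (labels A ++ labels B) (labels u ++ labels v).
  exact: perm_cat.
apply: span_sub (straighten gA gB _); last by rewrite (perm_uniq pAB).
move=> _ [t /andP[gt pt] ->]; apply: span_in; exists t => //.
by rewrite gt (perm_trans pt pAB).
Qed.

End LieBracket.

(** * Independence of the trees, by expansion into words *)

Section Words.
Variable R : comPzRingType.
Notation ncpoly := (seq nat -> R^o).

(** The product of noncommutative polynomials, that is of functions on words: the sum
    of f(w1) * g(w2) over all factorisations w = w1 w2.  The recursion on the word,
    with f replaced by its left quotient by the first letter, makes associativity
    an easy induction. *)
Fixpoint conv (f g : ncpoly) (w : seq nat) : R :=
  match w with
  | [::] => f [::] * g [::]
  | a :: w' => f [::] * g w + conv (fun v => f (a :: v)) g w'
  end.

Lemma conv_linl a (f f' g : ncpoly) w :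
  conv (a *: f + f') g w = a * conv f g w + conv f' g w.
Proof.
elim: w f f' => [|b w IH] f f' /=; first by rewrite mulrDl mulrA.
rewrite [X in _ + X = _](IH (fun v => f (b :: v)) (fun v => f' (b :: v))).
rewrite -[(a *: f + f') [::]]/(a * f [::] + f' [::]).
by ring.
Qed.

Lemma conv_linr a (f g g' : ncpoly) w :
  conv f (a *: g + g') w = a * conv f g w + conv f g' w.
Proof.
elim: w f => [|b w IH] f /=; rewrite ?IH.
  by rewrite -[(a *: g + g') [::]]/(a * g [::] + g' [::]); ring.
by rewrite -[(a *: g + g') (b :: w)]/(a * g (b :: w) + g' (b :: w)); ring.
Qed.

Lemma convA (f g h : ncpoly) w : conv (conv f g) h w = conv f (conv g h) w.
Proof.
elim: w f g h => [|a w IH] f g h /=; first by rewrite mulrA.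
rewrite [X in _ + X = _](conv_linl (f [::]) (fun v => g (a :: v))
  (conv (fun v => f (a :: v)) g) h w) IH.
by ring.
Qed.

Definition commut (f g : ncpoly) : ncpoly := fun w => conv f g w - conv g f w.

Lemma commut_lie : is_lie_bracket commut.
Proof.
have linl z a x y : commut (a *: x + y) z = a *: commut x z + commut y z.
  apply: funext => w; rewrite /commut conv_linl conv_linr.
  rewrite -[RHS]/(a * (conv x z w - conv z x w) + (conv y z w - conv z y w)).
  by ring.
have alt x : commut x x = 0 by apply: funext => w; rewrite /commut subrr.
have opp x y : commut x y = - commut y x.
  by apply: funext => w; rewrite /commut -[RHS]/(- (_ - _)) opprB.
split=> //.
- by move=> x a y z; rewrite opp linl opprD -scalerN -!opp.
- move=> x y z; apply: funext => w.
  have lin (f g h : ncpoly) v :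
      conv f (commut g h) v = conv f (conv g h) v - conv f (conv h g) v.
    rewrite /commut.
    have := conv_linr (-1) f (conv h g) (conv g h) v.
    rewrite mulN1r [RHS]addrC => <-; congr (conv f _ v); apply: funext => u.
    by rewrite addrC -[RHS]/(-1 * _ + _) mulN1r.
  have lin' (f g h : ncpoly) v :
      conv (commut g h) f v = conv g (conv h f) v - conv h (conv g f) v.
    rewrite /commut -!convA.
    have := conv_linl (-1) (conv h g) (conv g h) f v.
    rewrite mulN1r [RHS]addrC => <-; congr (conv _ f v); apply: funext => u.
    by rewrite addrC -[RHS]/(-1 * _ + _) mulN1r.
  rewrite -[LHS]/(commut x (commut y z) w + commut y (commut z x) w +
     commut z (commut x y) w).
  rewrite {1 3 5}/commut !lin !lin'.
  set A := conv x (conv y z) w; set B := conv x (conv z y) w.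
  set C := conv y (conv x z) w; set D := conv y (conv z x) w.
  set E := conv z (conv x y) w; set F := conv z (conv y x) w.
  rewrite -[RHS]/(0 : R) !opprB.
  by ring.
Qed.

Lemma conv0l (f g : ncpoly) w : (forall v, f v = 0) -> conv f g w = 0.
Proof.
elim: w f => [|a w IH] f f0 /=; first by rewrite f0 mul0r.
by rewrite f0 mul0r add0r; apply: IH => v; apply: f0.
Qed.

(** If f is homogeneous of degree p, only one factorisation of w contributes. *)
Lemma conv_homog p (f g : ncpoly) w : (forall v, size v != p -> f v = 0) ->
  conv f g w = if (p <= size w)%N then f (take p w) * g (drop p w) else 0.
Proof.
elim: w f p => [|a w IH] f [|p] fp //=; try by rewrite fp // mul0r.
  by rewrite conv0l ?addr0 // => v; apply: fp.
by rewrite fp // mul0r add0r (IH _ p) // => v vp; apply: fp.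
Qed.

(** The coefficient of a word in the expansion of a tree as an associative
    polynomial. *)
Definition coefw : tree -> ncpoly :=
  treeval commut (fun a w => (w == [:: a])%:R).

Lemma coefw_brE u v w : coefw (WBr u v) w =
  conv (coefw u) (coefw v) w - conv (coefw v) (coefw u) w.
Proof. by []. Qed.

Lemma coefw_supp t w : ~~ perm_eq w (labels t) -> coefw t w = 0.
Proof.
have sz u x : (forall y, ~~ perm_eq y (labels u) -> coefw u y = 0) ->
    size x != size (labels u) -> coefw u x = 0.
  by move=> h xu; apply: h; apply/negP => /perm_size e; rewrite e eqxx in xu.
elim: t w => [a|u IHu v IHv] w.
  by rewrite /coefw /=; case: eqP => [->|//]; rewrite perm_refl.
have cv x y : ~~ perm_eq w (labels x ++ labels y) ->
    (forall z, ~~ perm_eq z (labels x) -> coefw x z = 0) ->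
    (forall z, ~~ perm_eq z (labels y) -> coefw y z = 0) ->
    conv (coefw x) (coefw y) w = 0.
  move=> nw hx hy; rewrite (conv_homog (p := size (labels x))); last by move=> z; apply: sz.
  case: ifP => // _.
  have [px|/hx->] := boolP (perm_eq (take (size (labels x)) w) (labels x));
    last by rewrite mul0r.
  have [py|/hy->] := boolP (perm_eq (drop (size (labels x)) w) (labels y));
    last by rewrite mulr0.
  by case/negP: nw; rewrite -[w](cat_take_drop (size (labels x))) perm_cat.
rewrite coefw_brE => /= nw; rewrite !cv ?subrr //.
by rewrite perm_sym perm_catC perm_sym.
Qed.

Lemma coefw_br u v w : size w = (size (labels u) + size (labels v))%N ->
  coefw (WBr u v) w =
    coefw u (take (size (labels u)) w) * coefw v (drop (size (labels u)) w)
  - coefw v (take (size (labels v)) w) * coefw u (drop (size (labels v)) w).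
Proof.
have sz t x : size x != size (labels t) -> coefw t x = 0.
  by move=> xt; apply: coefw_supp; apply/negP => /perm_size e; rewrite e eqxx in xt.
move=> sw; rewrite coefw_brE (conv_homog _ _ (sz u)) (conv_homog _ _ (sz v)).
by rewrite sw leq_addr leq_addl.
Qed.

(** The leading word of a tree, read from its minimum (m = true) or from its maximum
    (m = false).  Either word determines the tree: the first is cut into the
    words of the branches just before the maximum, the second just before the
    minimum. *)
Fixpoint lead (m : bool) (t : tree) : seq nat :=
  match t with
  | WGen a => [:: a]
  | WBr u v => if m then lead true u ++ lead false v
               else lead false v ++ lead true u
  end.

Lemma perm_lead m t : perm_eq (lead m t) (labels t).
Proof.
elim: t m => [a|u IHu v IHv] [] //=; first exact: perm_cat.
by rewrite perm_catC perm_cat.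
Qed.

Lemma head_lead m t : minmax t ->
  head 0%N (lead m t) = if m then minlab t else maxlab t.
Proof.
have lead0 b x : lead b x != [::].
  by rewrite -size_eq0 (perm_size (perm_lead b x)) -lt0n labels_gt0.
have headc s s' : s != [::] -> head 0%N (s ++ s') = head 0%N s by case: s.
elim: t m => [a|u IHu v IHv]; first by case.
case=> /=.
  by move=> /and4P[gu _ mn _]; rewrite headc ?lead0 ?IHu //=; lia.
by move=> /and4P[_ gv _ mx]; rewrite headc ?lead0 ?IHv //=; lia.
Qed.

(** The order for which leading words are triangular.  In a word read from the minimum,
    a tree whose left branch is smaller can still cut the word before the maximum;
    in a word read from the maximum the same happens for the right branch.  Hence
    the two modes, which propagate to the branches as in the leading words. *)
Fixpoint tree_lt (m : bool) (t' t : tree) : Prop :=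
  match t', t with
  | WBr u' v', WBr u v =>
    size (labels t') = size (labels t) /\
    [\/ if m then (size (labels u') < size (labels u))%N
        else (size (labels v') < size (labels v))%N,
        tree_lt true u' u | u' = u /\ tree_lt false v' v]
  | _, _ => False
  end.

Lemma tree_lt_size m t' t : tree_lt m t' t -> size (labels t') = size (labels t).
Proof. by case: t' t => [?|? ?] [?|? ?] //= []. Qed.

Lemma tree_lt_wf m t : Acc (tree_lt m) t.
Proof.
have [n] := ubnP (size (labels t)); elim: n => [|n IHn] in m t *; first by rewrite ltn0.
case: t => [a|u v] sz; first by constructor=> -[].
(* Lexicographic: the size of the compared branch, then u, then v; the order preserves
   the total size, so the order on the branches is well founded by induction. *)
pose d u v := size (labels (if m then u else v)).
have [k] := ubnP (d u v); elim: k => [|k IHk] in u v sz *; first by rewrite ltn0.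
have szE x y : size (labels (WBr x y)) = (size (labels x) + size (labels y))%N.
  by rewrite /= size_cat.
have szu : (size (labels u) < n)%N by have := labels_gt0 v; rewrite szE in sz; lia.
elim: (IHn true u szu) v sz => {szu}u _ IHu v sz.
have szv : (size (labels v) < n)%N by have := labels_gt0 u; rewrite szE in sz; lia.
elim: (IHn false v szv) sz => {szv}v _ IHv sz duv.
constructor=> -[a []|u' v' [szE' lt]].
have sz' : (size (labels (WBr u' v')) < n.+1)%N by rewrite szE'.
rewrite !szE in szE'.
case: lt => [lt|lt|[uu lt]].
- by apply: IHk => //; move: lt duv; rewrite /d; case: (m); lia.
- apply: IHu => //; move: duv; rewrite /d; have := tree_lt_size lt.
  by case: (m); lia.
- rewrite uu in sz' *; apply: IHv => //; move: duv; rewrite /d.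
  by have := tree_lt_size lt; case: (m); lia.
Qed.

Lemma minlab_perm t t' : perm_eq (labels t) (labels t') -> minlab t = minlab t'.
Proof.
move=> /perm_mem e; apply/eqP; rewrite eqn_leq.
by rewrite !minlab_le // ?e ?minlab_in // -e minlab_in.
Qed.

Lemma maxlab_perm t t' : perm_eq (labels t) (labels t') -> maxlab t = maxlab t'.
Proof.
move=> /perm_mem e; apply/eqP; rewrite eqn_leq.
by rewrite !maxlab_ge // ?e ?maxlab_in // -e maxlab_in.
Qed.

Lemma coefw_notin t x w : x \in w -> x \notin labels t -> coefw t w = 0.
Proof.
by move=> xw xt; apply: coefw_supp; apply: contra xt => /perm_mem <-.
Qed.

Lemma uniq_labels_br u v : uniq (labels (WBr u v)) ->
  [/\ uniq (labels u), uniq (labels v),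
     forall x, x \in labels u -> x \notin labels v &
     forall x, x \in labels v -> x \notin labels u].
Proof.
rewrite /= cat_uniq => /and3P[uu /hasPn h uv]; split=> // x xu.
by apply/negP => /h; rewrite /= xu.
Qed.

Lemma size_lead m t : size (lead m t) = size (labels t).
Proof. exact/perm_size/perm_lead. Qed.

Lemma minmax_br u v : minmax (WBr u v) ->
  [/\ minmax u, minmax v, minlab (WBr u v) = minlab u & maxlab (WBr u v) = maxlab v].
Proof. by move=> /= /and4P[-> -> ? ?]; split=> //; lia. Qed.

(** A word a ++ b starting with the label that begins the mode-m words of t can only
    come from the product x * y of the branches, in that order, and from the cut
    after the first size-of-x letters.  If a is shorter than x, that prefix also
    contains the head of b, a label of y, so the coefficient vanishes; if the sizes
    agree the cut is between a and b. *)
Lemma coefw_br_cat m t u v a b :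
  let x := if m then u else v in let y := if m then v else u in
  uniq (labels t) -> minmax t ->
  t = WBr u v -> size (a ++ b) = size (labels t) -> (0 < size a)%N ->
  head 0%N a = (if m then minlab t else maxlab t) ->
  head 0%N b = (if m then maxlab t else minlab t) ->
  ((size a < size (labels x))%N -> coefw t (a ++ b) = 0) /\
  (size a = size (labels x) ->
     coefw t (a ++ b) = (-1) ^+ (~~ m) * (coefw x a * coefw y b)).
Proof.
move=> x y ut gt tE sz a0 ha hb; subst t.
have [uu uv duv dvu] := uniq_labels_br ut; have [gu gv mn mx] := minmax_br gt.
have hax : head 0%N a \in labels x.
  by rewrite ha /x; case: (m); rewrite ?mn ?mx ?minlab_in ?maxlab_in.
have hay : head 0%N a \notin labels y.
  by move: hax; rewrite /x /y; case: (m) => [/duv|/dvu].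
have w0 p : (0 < p)%N -> head 0%N a \in take p (a ++ b).
  by case: a a0 {ha sz hax hay} => // c a _ /=; case: p => // p _; rewrite mem_head.
have E : coefw (WBr u v) (a ++ b) = (-1) ^+ (~~ m) *
    (coefw x (take (size (labels x)) (a ++ b)) *
     coefw y (drop (size (labels x)) (a ++ b))).
  rewrite coefw_br; last by rewrite sz /= size_cat.
  rewrite /x /y in hax hay *; case: (m) hax hay => /= hax hay.
    by rewrite (coefw_notin (t := v) (w0 _ (labels_gt0 v))) // mul0r subr0 mul1r.
  by rewrite (coefw_notin (t := u) (w0 _ (labels_gt0 u))) // mul0r sub0r mulN1r.
split=> [lt|eq]; last by rewrite E -eq take_size_cat // drop_size_cat.
have b0 : b != [::].
  apply: contraTneq lt => b0; move: sz; rewrite b0 cats0 => ->.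
  by rewrite /x /= size_cat -leqNgt; case: (m); lia.
rewrite E (coefw_notin (x := head 0%N b)) ?mul0r ?mulr0 //.
  rewrite take_cat ltnNge ltnW //= mem_cat; apply/orP; right.
  case: b b0 {sz hb w0 E} => // c b _.
  by case: (_ - _)%N (subn_gt0 (size a) (size (labels x))) => [|p];
    rewrite ?lt //= mem_head.
by rewrite hb /x; case: (m); rewrite ?mn ?mx ?duv ?dvu ?minlab_in ?maxlab_in.
Qed.

Lemma lead_br m u v : lead m (WBr u v) =
  lead m (if m then u else v) ++ lead (~~ m) (if m then v else u).
Proof. by case: m. Qed.

Lemma coefw_lead_br m u v u' v' :
  let x := if m then u else v in let y := if m then v else u in
  let x' := if m then u' else v' in let y' := if m then v' else u' in
  minmax (WBr u v) -> minmax (WBr u' v') -> uniq (labels (WBr u v)) ->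
  perm_eq (labels (WBr u' v')) (labels (WBr u v)) ->
  ((size (labels x) < size (labels x'))%N ->
     coefw (WBr u' v') (lead m (WBr u v)) = 0) /\
  (size (labels x) = size (labels x') ->
     coefw (WBr u' v') (lead m (WBr u v)) =
     (-1) ^+ (~~ m) * (coefw x' (lead m x) * coefw y' (lead (~~ m) y))).
Proof.
move=> x y x' y' g g' ut pt.
have [gu gv mn mx] := minmax_br g.
rewrite lead_br -/x -/y -!(size_lead m x).
apply: coefw_br_cat => //.
- by rewrite (perm_uniq pt).
- by rewrite (perm_size pt) -(size_lead m) lead_br.
- by rewrite size_lead labels_gt0.
- rewrite (minlab_perm pt) (maxlab_perm pt) head_lead /x; last by case: (m).
  by case: (m); rewrite ?mn ?mx.
- rewrite (minlab_perm pt) (maxlab_perm pt) head_lead /y; last by case: (m).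
  by case: (m); rewrite ?mn ?mx.
Qed.

Lemma coefw_lead_diag m t : minmax t -> uniq (labels t) ->
  coefw t (lead m t) = 1 \/ coefw t (lead m t) = -1.
Proof.
elim: t m => [a|u IHu v IHv] m gt ut.
  by left; rewrite /coefw /=; case: m; rewrite eqxx.
have [_ ->] := @coefw_lead_br m u v u v gt gt ut (perm_refl _); last by [].
have [uu uv _ _] := uniq_labels_br ut; have [gu gv _ _] := minmax_br gt.
have {IHu} IHu := IHu _ gu uu; have {IHv} IHv := IHv _ gv uv.
by case: m => /=; case: (IHu true) => ->; case: (IHv false) => ->;
  rewrite ?mulN1r ?mul1r ?opprK; auto.
Qed.

(** Cutting the leading word of t according to the branches of t': a longer first
    branch of t' gives coefficient zero, a shorter one makes t' smaller, and for
    equal sizes the coefficient is a product, to which induction applies. *)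
Lemma coefw_lead_triangular m t t' : minmax t -> minmax t' -> uniq (labels t) ->
  perm_eq (labels t') (labels t) ->
  [\/ coefw t' (lead m t) = 0, t' = t | tree_lt m t' t].
Proof.
elim: t m t' => [a|u IHu v IHv] m [a'|u' v'] gt gt' ut pt.
- by constructor 2; have := perm_mem pt a; rewrite !inE eqxx => /eqP ->.
- by have := perm_size pt; have := labels_gt0 u'; have := labels_gt0 v';
    rewrite /= size_cat /=; lia.
- by have := perm_size pt; have := labels_gt0 u; have := labels_gt0 v;
    rewrite /= size_cat /=; lia.
have [z e] := coefw_lead_br m gt gt' ut pt.
have szt := perm_size pt.
have [uu uv _ _] := uniq_labels_br ut; have [gu gv _ _] := minmax_br gt.
have [gu' gv' _ _] := minmax_br gt'.
have [lt|gt0|eq] := ltngtP (size (labels (if m then u' else v')))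
  (size (labels (if m then u else v))); last 1 first.
- have {e} := e (esym eq).
  have supp b x x' : perm_eq (labels x') (labels x) \/ coefw x' (lead b x) = 0.
    have [p|n] := boolP (perm_eq (lead b x) (labels x')); last by right; exact: coefw_supp.
    by left; rewrite perm_sym -(permPl (perm_lead b x)).
  have [pu|zu] := supp true u u'; last first.
    by case: (m) => /= ->; rewrite zu ?mul0r ?mulr0; constructor.
  have [pv|zv] := supp false v v'; last first.
    by case: (m) => /= ->; rewrite zv ?mul0r ?mulr0; constructor.
  have [zu|eu|lu] := IHu true u' gu gu' uu pu.
  + by case: (m) => /= ->; rewrite zu ?mul0r ?mulr0; constructor.
  + have [zv|ev|lv] := IHv false v' gv gv' uv pv.
    * by case: (m) => /= ->; rewrite zv ?mul0r ?mulr0; constructor.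
    * by rewrite eu ev => _; constructor 2.
    * by move=> _; constructor 3; split=> //; constructor 3.
  + by move=> _; constructor 3; split=> //; constructor 2.
- by constructor 3; split=> //; constructor 1; case: (m) lt.
- by constructor 1; apply: z.
Qed.

(** The total coefficient of each tree vanishes, by well-founded induction on the
    tree: in the coefficient of its leading word, the smaller trees contribute zero
    by induction, the tree itself contributes its coefficient up to a sign, and no
    other tree contributes.  The conclusion, in an arbitrary module, is the form of
    linear independence that makes linear extension well defined. *)
Lemma trees_free (V : lmodType R) (v : tree -> V) (s : seq (R * tree)) r :
  uniq r -> all (fun p => minmax p.2 && perm_eq (labels p.2) r) s ->
  (forall w, \sum_(p <- s) p.1 * coefw p.2 w = 0) ->
  \sum_(p <- s) p.1 *: v p.2 = 0.
Proof.
move=> ur /allP sP s0.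
(* The list may repeat trees, so relations are regrouped by tree first. *)
pose c t := \sum_(p <- s | p.2 == t) p.1.
have regroup (W : lmodType R) (f : tree -> W) :
    \sum_(p <- s) p.1 *: f p.2 = \sum_(t <- undup (map snd s)) c t *: f t.
  rewrite (eq_bigr (fun t => \sum_(p <- s | p.2 == t) p.1 *: f p.2)); last first.
    by move=> t _; rewrite scaler_suml; apply: eq_bigr => p /eqP ->.
  rewrite (exchange_big_dep xpredT) //= big_seq [RHS]big_seq; apply: eq_bigr => p ps.
  rewrite (eq_bigl (pred1 p.2)) => [|t]; last by rewrite /= eq_sym.
  by rewrite -big_filter filter_pred1_uniq ?undup_uniq ?mem_undup ?map_f ?big_seq1.
suff c0 t : minmax t && perm_eq (labels t) r -> c t = 0.
  rewrite regroup big_seq big1 // => t; rewrite mem_undup => /mapP[p /sP pP ->].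
  by rewrite c0 // scale0r.
elim: (tree_lt_wf true t) => {}t _ IH /andP[gt pt].
have ut : uniq (labels t) by rewrite (perm_uniq pt).
have [ts|ts] := boolP (t \in undup (map snd s)); last first.
  rewrite /c big_seq_cond big1 // => p /andP[ps /eqP pt'].
  by case/negP: ts; rewrite mem_undup -pt' map_f.
have := regroup R^o (fun u => coefw u (lead true t) : R^o).
rewrite s0 (bigD1_seq t) ?undup_uniq //= big1_seq ?addr0.
  by case: (coefw_lead_diag true gt ut) => ->;
    rewrite /GRing.scale /= ?mulr1 ?mulrN1 => /eqP;
    rewrite eq_sym ?oppr_eq0 => /eqP.
move=> t' /andP[tt]; rewrite mem_undup => /mapP[p /sP /andP[gp pp] t'E].
have pt' : perm_eq (labels t') (labels t) by rewrite t'E (permPl pp) perm_sym.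
rewrite -t'E in gp pp.
have [z|e|lt] := coefw_lead_triangular true gt gp ut pt'.
- by rewrite z scaler0.
- by rewrite e eqxx in tt.
- by rewrite (IH _ lt) ?scale0r // gp pp.
Qed.

End Words.

(** * The set operad of trees, and blocks of a tree *)

Local Open Scope nat_scope.

Lemma eq_tree_subst (f g : nat -> tree) t :
  (forall a, a \in labels t -> f a = g a) ->
  lie_word_subst f t = lie_word_subst g t.
Proof.
elim: t => [a|u IHu v IHv] /= fg; first by rewrite fg ?mem_head.
by rewrite IHu ?IHv // => a at_; apply: fg; rewrite mem_cat at_ ?orbT.
Qed.

Lemma tree_subst_comp (f g : nat -> tree) t :
  lie_word_subst g (lie_word_subst f t) =
  lie_word_subst (fun a => lie_word_subst g (f a)) t.
Proof. by elim: t => //= u -> v ->. Qed.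

Lemma tree_subst_id (f : nat -> tree) t :
  (forall a, a \in labels t -> f a = WGen a) -> lie_word_subst f t = t.
Proof.
move=> /eq_tree_subst ->.
by elim: t => //= u -> v ->.
Qed.

Definition shift i : tree -> tree := lie_word_subst (fun a => WGen (a + i)).
Definition unshift i : tree -> tree := lie_word_subst (fun a => WGen (a - i)).

Lemma labels_shift i t : labels (shift i t) = [seq a + i | a <- labels t].
Proof. by rewrite lie_word_gens_subst /= flatten_map1. Qed.

Lemma unshift_shift i j t : unshift i (shift (j + i) t) = shift j t.
Proof.
by rewrite [LHS]tree_subst_comp; apply: eq_tree_subst => a _ /=; congr WGen; lia.
Qed.

Lemma shift0 t : shift 0 t = t.
Proof. by apply: tree_subst_id => a _; rewrite addn0. Qed.

Lemma shiftK i t : unshift i (shift i t) = t.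
Proof. by have := unshift_shift i 0 t; rewrite shift0. Qed.

Lemma unshiftK i t : (forall a, a \in labels t -> i <= a) ->
  shift i (unshift i t) = t.
Proof.
move=> ti; rewrite [LHS]tree_subst_comp; apply: tree_subst_id => a /ti ia /=.
by rewrite subnK.
Qed.

(** What the leaf j of s becomes in the composite of s with u at i, where n is the
    number of leaves of u. *)
Definition graft i n u j : tree :=
  if j < i then WGen j else if i < j then WGen (j + n).-1 else shift i u.

Definition circ i n (s u : tree) : tree := lie_word_subst (graft i n u) s.

Lemma labels_circ i n s u :
  labels (circ i n s u) = flatten [seq labels (graft i n u j) | j <- labels s].
Proof. exact: lie_word_gens_subst. Qed.

Lemma circ_br i n s s' u :
  circ i n (WBr s s') u = WBr (circ i n s u) (circ i n s' u).
Proof. by []. Qed.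

Lemma graft_i i n u : graft i n u i = shift i u.
Proof. by rewrite /graft ltnn. Qed.

Lemma circ_seq i j n p s u c : j < n ->
  circ (i + j) p (circ i n s u) c = circ i (n + p).-1 s (circ j p u c).
Proof.
move=> jn; rewrite [LHS]tree_subst_comp; apply: eq_tree_subst => a _.
rewrite [graft i n u a]/graft [graft i _ _ a]/graft; case: (ltngtP a i) => ai /=.
- by rewrite /graft; have -> : a < i + j by lia.
- rewrite /graft; have -> : ((a + n).-1 < i + j) = false by lia.
  have -> : i + j < (a + n).-1 by lia.
  by congr WGen; lia.
- rewrite /shift !tree_subst_comp; apply: eq_tree_subst => b _ /=.
  rewrite /graft; case: (ltngtP b j) => bj.
  + by have -> : b + i < i + j by lia.
  + have -> : (b + i < i + j) = false by lia.
    have -> : i + j < b + i by lia.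
    by rewrite /=; congr WGen; lia.
  + rewrite bj addnC ltnn /shift tree_subst_comp; apply: eq_tree_subst => d _ /=.
    by congr WGen; lia.
Qed.

Lemma circ_par i j j' n p s u c : i < j -> j'.+1 = j + n ->
  (forall a, a \in labels u -> a < n) ->
  circ j' p (circ i n s u) c = circ i n (circ j p s c) u.
Proof.
move=> ij jj un; rewrite [LHS]tree_subst_comp [RHS]tree_subst_comp.
apply: eq_tree_subst => a _; rewrite [graft i n u a]/graft [graft j p c a]/graft.
case: (ltngtP a i) => ai /=.
- have -> : a < j by lia.
  by rewrite /= /graft ai; have -> : a < j' by lia.
- case: (ltngtP a j) => aj /=.
  + rewrite /graft; have -> : (a < i) = false by lia.
    by rewrite ai; have -> : (a + n).-1 < j' by lia.
  + rewrite /graft; have -> : ((a + n).-1 < j') = false by lia.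
    have -> : j' < (a + n).-1 by lia.
    have -> : ((a + p).-1 < i) = false by lia.
    have -> : i < (a + p).-1 by lia.
    by congr WGen; lia.
  + have -> : (a + n).-1 = j' by lia.
    rewrite graft_i [RHS]tree_subst_comp; apply: eq_tree_subst => b _ /=.
    rewrite /graft; have -> : (b + j < i) = false by lia.
    have -> : i < b + j by lia.
    by congr WGen; lia.
- rewrite ai ij /= graft_i /shift tree_subst_comp; apply: eq_tree_subst => b /un bn /=.
  by rewrite /graft; have -> : b + i < j' by lia.
Qed.

Lemma circ1l n u : circ 0 n (WGen 0) u = u.
Proof. by rewrite /circ /= graft_i shift0. Qed.

Lemma circ1r i s : circ i 1 s (WGen 0) = s.
Proof.
apply: tree_subst_id => a _; rewrite /graft; case: ltngtP => //= [ai|->] //.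
by rewrite addn1.
Qed.

(** Collapses to a single leaf i the largest subtrees with all labels in the block
    [i, i + n) and renumbers the other leaves; left inverse to composing at i. *)
Fixpoint contr i n (t : tree) : tree :=
  if all (fun a => i <= a < i + n) (labels t) then WGen i else
  match t with
  | WGen a => WGen (if a < i then a else (a - n).+1)
  | WBr u v => WBr (contr i n u) (contr i n v)
  end.

Lemma contr_in i n t : all (fun a => i <= a < i + n) (labels t) -> contr i n t = WGen i.
Proof. by case: t => [a|u v] /= ->. Qed.

(** The monotone map on labels that underlies [contr]. *)
Definition collapse i n a := if a < i then a else if a < i + n then i else (a - n).+1.

Lemma collapse_mono i n a b : a <= b -> collapse i n a <= collapse i n b.
Proof. by rewrite /collapse; do ?case: ifP; lia. Qed.

Lemma collapse_graft i n u j a : 0 < n -> (forall b, b \in labels u -> b < n) ->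
  a \in labels (graft i n u j) -> collapse i n a = j.
Proof.
move=> n0 un; rewrite /graft /collapse.
case: ltngtP => [ji|ij|->]; last first.
- by rewrite labels_shift => /mapP[b /un bn ->]; do ?case: ifP; lia.
- by rewrite inE => /eqP->; do ?case: ifP; lia.
- by rewrite inE => /eqP->; do ?case: ifP; lia.
Qed.

Section Circ.
Variables (i n : nat) (u : tree).
Hypotheses (n0 : 0 < n) (un : forall b, b \in labels u -> b < n).

Lemma mem_circ s a : a \in labels (circ i n s u) ->
  collapse i n a \in labels s /\ a \in labels (graft i n u (collapse i n a)).
Proof.
by rewrite labels_circ => /flatten_mapP[j js aj]; rewrite (collapse_graft n0 un aj).
Qed.

(** No bracket of s acquires all its labels in the block: if it did, both its branches
    would contain the leaf i. *)
Lemma contr_circ s : uniq (labels s) -> contr i n (circ i n s u) = s.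
Proof.
elim: s => [j|x IHx y IHy].
  rewrite /circ /= /graft; case: ltngtP => [ji|ij|->] _ /=.
  - by rewrite ifF ?ji //; lia.
  - by rewrite ifF; [congr WGen; rewrite ifF; lia | lia].
  - apply: contr_in; rewrite labels_shift; apply/allP => _ /mapP[b /un bn ->]; lia.
move=> uxy; have := uxy; rewrite /= cat_uniq => /and3P[ux /hasPn dxy uy].
rewrite -/(circ _ _ _ _) ifF; first by rewrite IHx ?IHy.
apply/negP; rewrite all_cat => /andP[/allP ax /allP ay].
have bl t : (forall a, a \in labels (circ i n t u) -> i <= a < i + n) -> i \in labels t.
  (* A label in the block collapses to i, hence i labels the tree. *)
  move=> h; have m := minlab_in (circ i n t u); have [+ _] := mem_circ m.
  rewrite /collapse; have := h _ m => /andP[h1 h2].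
  by rewrite ltnNge h1 h2.
by have := dxy _ (bl _ ay); rewrite /= (bl _ ax).
Qed.

Lemma minlab_circ s : collapse i n (minlab (circ i n s u)) = minlab s.
Proof.
elim: s => [j|x IHx y IHy].
  exact: collapse_graft n0 un (minlab_in (graft i n u j)).
rewrite circ_br /= -IHx -IHy.
have mono := @collapse_mono i n.
set a := minlab _; set b := minlab (circ i n y u).
have [ab|ba] := ltnP a b.
  by apply/esym/minn_idPl; apply: mono; apply: ltnW.
by apply/esym/minn_idPr; apply: mono.
Qed.

Lemma maxlab_circ s : collapse i n (maxlab (circ i n s u)) = maxlab s.
Proof.
elim: s => [j|x IHx y IHy].
  exact: collapse_graft n0 un (maxlab_in (graft i n u j)).
rewrite circ_br /= -IHx -IHy.
have mono := @collapse_mono i n.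
set a := maxlab _; set b := maxlab (circ i n y u).
have [ab|ba] := leqP a b.
  by apply/esym/maxn_idPr; apply: mono.
by apply/esym/maxn_idPl; apply: mono; apply: ltnW.
Qed.

Lemma minmax_graft j : minmax u -> minmax (graft i n u j).
Proof.
rewrite /graft; case: ltngtP => // _; elim: (u) => //= x IHx y IHy.
have mn t : minlab (shift i t) = minlab t + i.
  by elim: t => //= a -> b ->; rewrite addn_minl.
have mx t : maxlab (shift i t) = maxlab t + i.
  by elim: t => //= a -> b ->; rewrite addn_maxl.
by rewrite -!/(shift _ _) !mn !mx !ltn_add2r => /and4P[/IHx-> /IHy-> -> ->].
Qed.

(** [collapse] is monotone and sends the extreme labels of a composite to those of s,
    so the strict inequalities between branches of s lift to the composite. *)
Lemma minmax_circ s : minmax s -> minmax u -> minmax (circ i n s u).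
Proof.
move=> gs gu; elim: s gs => [j|x IHx y IHy] /=; first by rewrite minmax_graft.
rewrite -!/(circ _ _ _ _) => /and4P[/IHx-> /IHy-> /=].
rewrite -(minlab_circ x) -(minlab_circ y) -(maxlab_circ x) -(maxlab_circ y) => mn mx.
by apply/andP; split; rewrite ltnNge; apply/negP => /(collapse_mono i n); lia.
Qed.

(** Conversely the inequalities descend weakly along [collapse], and equality is
    excluded because the branches of s have disjoint labels. *)
Lemma circ_minmax s : uniq (labels s) -> minmax (circ i n s u) -> minmax s.
Proof.
elim: s => [//|x IHx y IHy] us.
have := us; rewrite /= cat_uniq => /and3P[ux /hasPn dxy uy].
rewrite -!/(circ _ _ _ _) => /and4P[/(IHx ux)-> /(IHy uy)-> mn mx] /=.
have dis a : a \in labels x -> a \in labels y -> False by move=> ax /dxy; rewrite /= ax.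
apply/andP; split; rewrite ltn_neqAle.
  rewrite -{2}(minlab_circ x) -{2}(minlab_circ y) collapse_mono 1?ltnW // andbT.
  by apply/eqP => e; apply: (dis (minlab x)); rewrite ?minlab_in // e minlab_in.
rewrite -{2}(maxlab_circ x) -{2}(maxlab_circ y) collapse_mono 1?ltnW // andbT.
by apply/eqP => e; apply: (dis (maxlab x)); rewrite ?maxlab_in // e maxlab_in.
Qed.

End Circ.

Definition valid n t := minmax t && perm_eq (labels t) (iota 0 n).

Lemma valid_size n t : valid n t -> size (labels t) = n.
Proof. by move=> /andP[_ /perm_size ->]; rewrite size_iota. Qed.

Lemma valid_gt0 n t : valid n t -> 0 < n.
Proof. by move=> /valid_size <-; exact: labels_gt0. Qed.

Lemma valid_uniq n t : valid n t -> uniq (labels t).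
Proof. by move=> /andP[_ /perm_uniq ->]; rewrite iota_uniq. Qed.

Lemma valid_mem n t a : valid n t -> (a \in labels t) = (a < n).
Proof. by move=> /andP[_ /perm_mem ->]; rewrite mem_iota. Qed.

Lemma valid_circ m n k i s u : m + n = k.+1 -> i < m ->
  valid m s -> valid n u -> valid k (circ i n s u).
Proof.
move=> mnk im vs vu; have n0 := valid_gt0 vu.
have un b : b \in labels u -> b < n by rewrite (valid_mem _ vu).
have [[gs ps] [gu pu]] := (andP vs, andP vu).
apply/andP; split; first exact: minmax_circ.
rewrite labels_circ.
have -> : k = i + (n + (m - i.+1)) by lia.
apply: (perm_trans (perm_flatten (perm_map _ ps))).
have mE : m = i + (m - i.+1).+1 by lia.
move: (m - i.+1) mE => r ->.
rewrite !iotaD map_cat flatten_cat /= add0n graft_i labels_shift.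
have low (l : seq nat) d : (forall j, j \in l -> labels (graft i n u j) = [:: d + j]) ->
    flatten [seq labels (graft i n u j) | j <- l] = [seq d + j | j <- l].
  elim: l => //= j l IHl h; rewrite h ?mem_head // IHl // => j' j'l.
  by apply: h; rewrite inE j'l orbT.
rewrite (low _ 0) => [|j]; last first.
  by rewrite mem_iota /graft => /andP[_ ->].
rewrite (low _ n.-1) => [|j]; last first.
  rewrite mem_iota /graft => /andP[ij _]; rewrite ltnNge ltnW //= ij /=.
  by congr [:: _]; lia.
rewrite -iotaDl addn0 perm_cat2l -!iotaDl.
have -> : n.-1 + i.+1 = i + n by lia.
rewrite perm_cat2r.
rewrite (_ : iota i n = [seq a + i | a <- iota 0 n]); first exact: perm_map.
by rewrite -[in LHS](addn0 i) iotaDl; apply: eq_map => a; rewrite addnC.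
Qed.

Lemma circ_valid m n k i s u : m + n = k.+1 -> i \in labels s ->
  valid n u -> valid k (circ i n s u) -> valid m s.
Proof.
move=> mnk is_ vu vt; have n0 := valid_gt0 vu.
have un b : b \in labels u -> b < n by rewrite (valid_mem _ vu).
have ft j : labels (graft i n u j) != [::] by rewrite -size_eq0 -lt0n labels_gt0.
have us : uniq (labels s).
  have := valid_uniq vt; rewrite labels_circ.
  elim: (labels s) => //= j l IHl; rewrite cat_uniq => /and3P[_ /hasPn dj /IHl ->].
  rewrite andbT; apply/negP => jl.
  have [a al] : exists a, a \in labels (graft i n u j).
    by exists (minlab (graft i n u j)); exact: minlab_in.
  have : a \in flatten [seq labels (graft i n u j) | j <- l].
    by apply/flatten_mapP; exists j.
  by move=> /dj /=; rewrite al.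
have gt : minmax (circ i n s u) by case/andP: vt.
have im : i < m.
  have un1 : n.-1 \in labels u by rewrite (valid_mem _ vu); lia.
  suff : n.-1 + i \in labels (circ i n s u) by rewrite (valid_mem _ vt); lia.
  rewrite labels_circ; apply/flatten_mapP; exists i => //.
  by rewrite graft_i labels_shift; apply/mapP; exists n.-1.
rewrite /valid (circ_minmax n0 un us gt) /=.
apply: uniq_perm; rewrite ?iota_uniq // => j; rewrite mem_iota add0n /=.
apply/idP/idP => [js|jm].
  case: (ltngtP j i) => [||->] //; try lia.
  move=> ij; suff : (j + n).-1 \in labels (circ i n s u).
    by rewrite (valid_mem _ vt); lia.
  rewrite labels_circ; apply/flatten_mapP; exists j => //.
  by rewrite /graft ltnNge ltnW //= ij mem_head.
have : (if j <= i then j else (j + n).-1) \in labels (circ i n s u).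
  by rewrite (valid_mem _ vt); case: ifP; lia.
have cj : collapse i n (if j <= i then j else (j + n).-1) = j.
  by rewrite /collapse; do ?case: ifP; lia.
by move=> /(mem_circ n0 un) []; rewrite cj.
Qed.

Fixpoint occ (v t : tree) : Prop :=
  v = t \/ if t is WBr x y then occ v x \/ occ v y else False.

Lemma occ_refl t : occ t t.
Proof. by case: t => [?|? ?]; left. Qed.

Lemma occ_labels v t a : occ v t -> a \in labels v -> a \in labels t.
Proof.
elim: t => [b|x IHx y IHy] /= [->|] //.
by rewrite mem_cat => -[/IHx h /h ->|/IHy h /h ->]; rewrite ?orbT.
Qed.

Lemma occ_subst (f : nat -> tree) v t :
  occ v t -> occ (lie_word_subst f v) (lie_word_subst f t).
Proof.
elim: t => [b|x IHx y IHy] /= [->|] //; first exact: occ_refl.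
  by left.
by move=> [/IHx h|/IHy h]; right; [left|right].
Qed.

Lemma occ_laminar t v v' : uniq (labels t) -> occ v t -> occ v' t ->
  [\/ occ v v', occ v' v | forall a, a \in labels v -> a \notin labels v'].
Proof.
elim: t => [b|x IHx y IHy] ut.
  by move=> [->|//] [->|//]; constructor 1; exact: occ_refl.
move=> ov ov'; case: (ov) => [->|]; first by constructor 2.
case: (ov') => [->|]; first by constructor 1.
move: ut; rewrite /= cat_uniq => /and3P[ux /hasPn dxy uy].
move=> [ov'1|ov'1] [ov1|ov1]; [exact: IHx| | |exact: IHy]; constructor 3 => a av.
  by apply/negP => av'; have := dxy _ (occ_labels ov1 av); rewrite /= (occ_labels ov'1 av').
by apply/negP => /(occ_labels ov'1) /dxy; rewrite /= (occ_labels ov1 av).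
Qed.

Lemma occ_shift i n s u : i \in labels s -> occ (shift i u) (circ i n s u).
Proof.
elim: s => [j|x IHx y IHy] /=.
  by rewrite inE => /eqP <-; rewrite /circ /= graft_i; exact: occ_refl.
by rewrite mem_cat => /orP[/IHx|/IHy] h; right; [left|right].
Qed.

(** Away from the block, collapsing and composing only renumber, in inverse ways. *)
Lemma contr_out i n t u : (forall a, a \in labels t -> ~~ (i <= a < i + n)) ->
  circ i n (contr i n t) u = t.
Proof.
elim: t => [a|x IHx y IHy] h /=.
  have ha := h a (mem_head _ _); rewrite andbT (negbTE ha) /circ /=.
  case: (ltnP a i) => ai; rewrite /graft; first by rewrite ai.
  by rewrite ifF; [rewrite ifT; [congr WGen|]|]; lia.
rewrite ifF; last first.
  apply/negP => /allP /(_ (minlab x)); rewrite mem_cat minlab_in => /(_ isT).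
  by apply/negP/h; rewrite /= mem_cat minlab_in.
rewrite circ_br IHx ?IHy // => a ha; apply: h; rewrite /= mem_cat ha ?orbT //.
Qed.

(** A subtree whose labels form an interval can be factored out: this converse of
    [occ_shift] makes factorisations of t the same thing as blocks of t. *)
Lemma occ_circ i n v t : uniq (labels t) -> occ v t ->
  perm_eq (labels v) (iota i n) ->
  circ i n (contr i n t) (unshift i v) = t /\ i \in labels (contr i n t).
Proof.
move=> ut ov pv.
have vin a : (a \in labels v) = (i <= a < i + n) by rewrite (perm_mem pv) mem_iota.
have whole : circ i n (contr i n v) (unshift i v) = v /\ i \in labels (contr i n v).
  rewrite contr_in; last by apply/allP => a; rewrite vin.
  rewrite /circ /= graft_i unshiftK ?mem_head // => a.
  by rewrite vin => /andP[].
elim: t => [b|x IHx y IHy] in ut ov *; first by case: ov => [<-|].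
case: (ov) => [<- //|ovxy].
move: ut; rewrite /= cat_uniq => /and3P[ux /hasPn dxy uy].
have out z w : occ v z -> (forall a, a \in labels z -> a \notin labels w) ->
    forall a, a \in labels w -> ~~ (i <= a < i + n).
  move=> oz zw a aw; apply/negP; rewrite -vin => /(occ_labels oz) /zw.
  by rewrite aw.
have not_in z a : a \in labels z -> ~~ (i <= a < i + n) ->
   z = x \/ z = y ->
   all (fun a => i <= a < i + n) (labels x ++ labels y) = false.
  move=> az na zxy; apply/negP => /allP /(_ a); rewrite mem_cat (negbTE na).
  by case: zxy az => -> ->; rewrite ?orbT => /(_ isT).
have dyx a : a \in labels x -> a \notin labels y.
  by move=> ax; apply/negP => /dxy; rewrite /= ax.
case: ovxy => [ovx|ovy].
- have o := out x y ovx dyx.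
  rewrite (not_in y _ (minlab_in y) (o _ (minlab_in y))); last by right.
  have [ex ix] := IHx ux ovx.
  by rewrite circ_br ex contr_out //= mem_cat ix.
- have o := out y x ovy dxy.
  rewrite (not_in x _ (minlab_in x) (o _ (minlab_in x))); last by left.
  have [ey iy] := IHy uy ovy.
  by rewrite circ_br ey contr_out //= mem_cat iy orbT.
Qed.

Lemma contr_shift i n j u : 0 < n -> i + n <= j ->
  contr i n (shift j u) = shift (j - n).+1 u.
Proof.
move=> n0 inj; elim: u => [a|x IHx y IHy] /=.
  by rewrite ifF; [congr WGen; rewrite ifF; lia | lia].
rewrite -!/(shift _ _) IHx IHy ifF //; apply/negP => /allP /(_ (minlab (shift j x))).
rewrite mem_cat minlab_in => /(_ isT).
by have := minlab_in (shift j x); rewrite {1}labels_shift => /mapP[a _ ->]; lia.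
Qed.

(** A subtree of a composite which avoids the inserted block comes from s. *)
Lemma occ_contr i n u v s : 0 < n -> (forall b, b \in labels u -> b < n) ->
  uniq (labels s) -> occ v (circ i n s u) ->
  (forall a, a \in labels v -> ~~ (i <= a < i + n)) -> occ (contr i n v) s.
Proof.
move=> n0 un; elim: s => [j|x IHx y IHy] us ov hv.
  have hi : j != i.
    apply/eqP => ji; move: ov; rewrite ji /circ /= graft_i => ov.
    have := hv _ (minlab_in v); have := occ_labels ov (minlab_in v).
    by rewrite labels_shift => /mapP[b /un bn ->]; lia.
  have -> : v = circ i n (WGen j) u.
    by move: ov; rewrite /circ /= /graft; case: ltngtP hi => //= _ _ [].
  by rewrite contr_circ //; exact: occ_refl.
case: ov => [e|].
  have -> : v = circ i n (WBr x y) u := e.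
  by rewrite contr_circ //; left.
move: us; rewrite /= cat_uniq => /and3P[ux _ uy].
by rewrite -!/(circ _ _ _ _) => -[ov|ov]; right; [left; exact: IHx|right; exact: IHy].
Qed.

Record splits k t m n i s u : Prop := Splits {
  splits_arity : m + n = k.+1;
  splits_lt : i < m;
  splits_top : valid m s;
  splits_bot : valid n u;
  splitsE : t = circ i n s u }.

Section Splits.
Variables (k : nat) (t : tree).

Lemma splits_valid m n i s u : splits k t m n i s u -> valid k t.
Proof. by case=> mnk im vs vu ->; exact: valid_circ vs vu. Qed.

Lemma splits_contr m n i s u : splits k t m n i s u -> contr i n t = s.
Proof.
case=> mnk im vs vu ->; apply: contr_circ (valid_uniq vs).
  exact: valid_gt0 vu.
by move=> b; rewrite (valid_mem _ vu).
Qed.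

Lemma splits_occ m n i s u : splits k t m n i s u -> occ (shift i u) t.
Proof. by case=> mnk im vs vu ->; apply: occ_shift; rewrite (valid_mem _ vs). Qed.

Lemma mem_shift n i u a : valid n u -> (a \in labels (shift i u)) = (i <= a < i + n).
Proof.
move=> vu; rewrite labels_shift; apply/mapP/idP => [[b + ->]|ia].
  by rewrite (valid_mem _ vu); lia.
by exists (a - i); rewrite ?(valid_mem _ vu); lia.
Qed.

Lemma perm_shift n i u : valid n u -> perm_eq (labels (shift i u)) (iota i n).
Proof.
move=> vu; apply: uniq_perm; rewrite ?iota_uniq //.
  rewrite labels_shift map_inj_uniq ?(valid_uniq vu) // => a b; exact: addIn.
by move=> a; rewrite (mem_shift _ _ vu) mem_iota.
Qed.

(** A block inside the block of u is a block of u, up to the shift by i.  Factoring it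
    out of u and reassociating gives a factorisation of t at this block, which is the
    given one since collapsing recovers the top tree. *)
Lemma splits_nested m n i s u m' n' i' s' u' :
  splits k t m n i s u -> splits k t m' n' i' s' u' ->
  occ (shift i' u') (shift i u) ->
  exists r j w, [/\ i' = i + j, splits n u r n' j w u' & splits m' s' m r i s w].
Proof.
move=> d d' o; have [mnk im vs vu tE] := d; have [mnk' im' vs' vu' tE'] := d'.
have n'0 := valid_gt0 vu'; have m0 := valid_gt0 vs.
have lab a : i' <= a < i' + n' -> i <= a < i + n.
  by rewrite -(mem_shift _ _ vu') -(mem_shift _ _ vu); exact: occ_labels.
have ii := lab i'; have ii' := lab (i' + n').-1.
have [j jE] : exists j, i' = i + j by exists (i' - i); lia.
have oj : occ (shift j u') u.
  have := occ_subst (fun a => WGen (a - i)) o.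
  rewrite -!/(unshift _ _) jE [i + j]addnC unshift_shift.
  by rewrite shiftK.
have [uE jw] := occ_circ (valid_uniq vu) oj (perm_shift j vu').
rewrite shiftK in uE.
set w := contr j n' u in uE jw.
have rn : (n.+1 - n') + n' = n.+1 by lia.
have vw : valid (n.+1 - n') w by apply: circ_valid rn jw vu' _; rewrite uE.
have jr : j < n.+1 - n' by rewrite -(valid_mem _ vw).
have du : splits n u (n.+1 - n') n' j w u' by split.
exists (n.+1 - n'), j, w; split=> //.
have m'E : m + (n.+1 - n') = m'.+1 by lia.
split=> //.
have d2 : splits k t m' n' i' (circ i (n.+1 - n') s w) u'.
  split=> //; first exact: valid_circ m'E im vs vw.
  by rewrite jE circ_seq // uE tE; congr circ; lia.
by rewrite -(splits_contr d') (splits_contr d2).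
Qed.

(** A block to the right of that of u survives as a block of s, moved left by n - 1.
    Factoring it out of s and exchanging the two compositions gives a factorisation
    of t at this block, again the given one by collapsing. *)
Lemma splits_disjoint m n i s u m' n' i' s' u' :
  splits k t m n i s u -> splits k t m' n' i' s' u' -> i + n <= i' ->
  exists r j w, [/\ i < j, i'.+1 = j + n, splits m s r n' j w u' &
                    splits m' s' r n i w u].
Proof.
move=> d d' ini'; have [mnk im vs vu tE] := d; have [mnk' im' vs' vu' tE'] := d'.
have n0 := valid_gt0 vu; have n'0 := valid_gt0 vu'.
have un b : b \in labels u -> b < n by rewrite (valid_mem _ vu).
(* Position of the second block once the first one is collapsed to a leaf. *)
pose j := (i' - n).+1.
have oj : occ (shift j u') s.
  rewrite -(contr_shift (i := i)) //.
  apply: (occ_contr n0 un (valid_uniq vs)); first by rewrite -tE; exact: splits_occ d'.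
  by move=> a; rewrite (mem_shift _ _ vu'); lia.
have [sE jw] := occ_circ (valid_uniq vs) oj (perm_shift j vu').
rewrite shiftK in sE.
set w := contr j n' s in sE jw.
have rn : (m.+1 - n') + n' = m.+1 by have := valid_gt0 vs'; lia.
have vw : valid (m.+1 - n') w by apply: circ_valid rn jw vu' _; rewrite sE.
have jr : j < m.+1 - n' by rewrite -(valid_mem _ vw).
have ij : i < j by lia.
exists (m.+1 - n'), j, w; split=> //; [lia | split=> //; try lia].
have d2 : splits k t m' n' i' (circ i n w u) u'.
  split=> //; first by apply: valid_circ vw vu; lia.
  by rewrite (@circ_par i j) ?sE //; lia.
by rewrite -(splits_contr d') (splits_contr d2).
Qed.

Lemma splits_cases m n i s u m' n' i' s' u' :
  splits k t m n i s u -> splits k t m' n' i' s' u' ->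
  [\/ occ (shift i' u') (shift i u), occ (shift i u) (shift i' u'),
      i + n <= i' | i' + n' <= i].
Proof.
move=> d d'; have ut := valid_uniq (splits_valid d).
have [_ _ _ vu _] := d; have [_ _ _ vu' _] := d'.
have [n0 n'0] := (valid_gt0 vu, valid_gt0 vu').
have [o|o|dis] := occ_laminar ut (splits_occ d) (splits_occ d').
- by constructor 2.
- by constructor 1.
- have [?|h] := leqP (i + n) i'; first by constructor 3.
  have [?|h'] := leqP (i' + n') i; first by constructor 4.
  exfalso; have := dis (maxn i i').
  by rewrite (mem_shift _ _ vu) (mem_shift _ _ vu'); lia.
Qed.

End Splits.

(** * A basis of each Lie(n) *)

Local Open Scope ring_scope.

Section LieBasis.
Variable R : comPzRingType.

Definition flie_tree n : tree -> flie R 'I_n :=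
  treeval (@flie_br R 'I_n) (flie_x R n).

Lemma flie_tree_word n (w : lie_word 'I_n) :
  flie_word R w = flie_tree n (lie_word_subst (fun i => WGen (val i)) w).
Proof. by elim: w => [i|u /= -> v ->] //; rewrite /flie_tree /= flie_xE. Qed.

Lemma labels_word n (w : lie_word 'I_n) : multilinear_word w ->
  perm_eq (labels (lie_word_subst (fun i => WGen (val i)) w)) (iota 0 n).
Proof.
move=> mw; rewrite lie_word_gens_subst /= flatten_map1 -val_enum_ord.
exact: perm_map.
Qed.

Lemma flie_tree_shift n k i t : (forall a, a \in labels t -> (a < n)%N) ->
  lie_shift k i (flie_tree n t) = flie_tree k (shift i t).
Proof.
elim: t => [a|u IHu v IHv] h /=; first by rewrite /flie_tree lie_shift_x // h ?mem_head.
rewrite /flie_tree /lie_shift /= flie_subst_br -!/(lie_shift _ _ _) IHu ?IHv //.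
  by move=> a av; apply: h; rewrite /= mem_cat av orbT.
by move=> a av; apply: h; rewrite /= mem_cat av.
Qed.

(** This makes the structure of Lie combinatorial: composites of basis trees are basis
    trees, with coefficient one. *)
Lemma flie_tree_circ m n k (i : 'I_m) s u :
  (forall a, a \in labels s -> (a < m)%N) ->
  (forall a, a \in labels u -> (a < n)%N) ->
  lie_circ k i (flie_tree m s) (flie_tree n u) = flie_tree k (circ i n s u).
Proof.
move=> hs hu; elim: s hs => [a|x IHx y IHy] h.
  have am : (a < m)%N by rewrite h ?mem_head.
  rewrite /circ /= /graft /flie_tree /=; case: (ltngtP a i) => ai /=.
  - by rewrite lie_circ_xl.
  - by rewrite lie_circ_xr ?ai.
  - by rewrite lie_circ_xi //; exact: flie_tree_shift.
rewrite /flie_tree /= lie_circ_br IHx ?IHy //.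
  by move=> a av; apply: h; rewrite /= mem_cat av orbT.
by move=> a av; apply: h; rewrite /= mem_cat av.
Qed.

Lemma flie_tree_span n t : valid n t -> flie_tree n t \in @lie_span R n.
Proof.
case: n => [|n] vt; first by have := valid_gt0 vt.
pose w : lie_word 'I_n.+1 := lie_word_subst (fun a => WGen (inord a)) t.
have wt : lie_word_subst (fun i => WGen (val i)) w = t.
  have : forall a, a \in labels t -> (a < n.+1)%N by move=> a; rewrite (valid_mem _ vt).
  rewrite {}/w; elim: (t) => [a|u IHu v IHv] h /=; first by rewrite inordK // h ?mem_head.
  by rewrite IHu ?IHv // => a av; apply: h; rewrite /= mem_cat av ?orbT.
have mw : multilinear_word w.
  rewrite /multilinear_word lie_word_gens_subst /= flatten_map1.
  have [_ /(perm_map (inord : nat -> 'I_n.+1)) /permPl ->] := andP vt.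
  rewrite -val_enum_ord -map_comp (eq_map (g := id)) ?map_id // => i /=.
  exact: inord_val.
apply/asboolP; exists [:: (1, w)]; first by rewrite /= mw.
by rewrite big_seq1 scale1r flie_tree_word wt.
Qed.

Definition lie_basis n t : lieMod R n := insubd 0 (flie_tree n t).

Lemma lie_basisE n t : valid n t -> lie_val (lie_basis n t) = flie_tree n t.
Proof. by move=> vt; apply: insubdK; apply: flie_tree_span. Qed.

Lemma lie_basis_unit : lie_basis 1 (WGen 0) = lie_unit R.
Proof. by apply: val_inj; rewrite [LHS]lie_basisE //; exact: (flie_xE R (ord0 : 'I_1)). Qed.

Lemma lie_basis_comp m n k (mnk : (m + n)%N = k.+1) (i : 'I_m) s u :
  valid m s -> valid n u ->
  lie_comp mnk i (lie_basis m s) (lie_basis n u) = lie_basis k (circ i n s u).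
Proof.
move=> vs vu; apply: val_inj; rewrite [RHS]lie_basisE ?(valid_circ mnk) //=.
rewrite !lie_basisE // flie_tree_circ // => a; first by rewrite (valid_mem _ vs).
by rewrite (valid_mem _ vu).
Qed.

Lemma lie_basis_span n (x : lieMod R n) :
  exists2 s : seq (R * tree), all (fun p => valid n p.2) s &
    x = \sum_(p <- s) p.1 *: lie_basis n p.2.
Proof.
pose P (y : flie R 'I_n) := exists2 t, valid n t & y = flie_tree n t.
have : lspan P (lie_val x).
  have [s /allP sm ->] := asboolP _ (lie_valP x).
  rewrite big_seq; apply: (big_ind (lspan P)) => [||p ps]; first exact: span0.
    exact: spanD.
  apply: spanZ; rewrite flie_tree_word.
  have pl := labels_word (sm p ps).
  apply: span_sub (treeval_span (@flie_br_lie R 'I_n) (flie_x R n) _); last first.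
    by rewrite (perm_uniq pl) iota_uniq.
  move=> _ [t /andP[gt pt] ->]; apply: span_in; exists t => //.
  by rewrite /valid gt (perm_trans pt pl).
have sumE s : all (fun p => valid n p.2) s ->
    lie_val (\sum_(p <- s) p.1 *: lie_basis n p.2) =
    \sum_(p <- s) p.1 *: flie_tree n p.2.
  move=> /allP sv; rewrite -[LHS]/(val _) linear_sum big_seq [RHS]big_seq.
  by apply: eq_bigr => p /sv vp; rewrite linearZ /= lie_basisE.
move=> sp; suff [s sv e] : exists2 s : seq (R * tree), all (fun p => valid n p.2) s &
    lie_val x = \sum_(p <- s) p.1 *: flie_tree n p.2.
  by exists s => //; apply: val_inj; rewrite [RHS]sumE.
elim: sp => [|a _ z [t vt ->] _ [s sv ->]]; first by exists [::]; rewrite ?big_nil.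
by exists ((a, t) :: s); rewrite /= ?vt // big_cons.
Qed.

(** The map to noncommutative polynomials given by the universal property of the free
    Lie algebra reduces this to independence in the latter. *)
Lemma lie_basis_free n (V : lmodType R) (v : tree -> V) (s : seq (R * tree)) :
  all (fun p => valid n p.2) s -> \sum_(p <- s) p.1 *: lie_basis n p.2 = 0 ->
  \sum_(p <- s) p.1 *: v p.2 = 0.
Proof.
move=> sv s0; apply: (trees_free v (iota_uniq 0 n) sv) => w.
pose f (i : 'I_n) : seq nat -> R^o := fun w => (w == [:: val i])%:R.
pose F := flie_lift (@commut R) f.
have Flin : linear F := flie_lift_linear f (@commut_lie R).
have Ftree t : (forall a, a \in labels t -> (a < n)%N) -> F (flie_tree n t) = coefw R t.
  elim: t => [a|x IHx y IHy] h.
    have an : (a < n)%N by rewrite h ?mem_head.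
    by rewrite /flie_tree /= (flie_xE R (Ordinal an)) [LHS]flie_lift_gen //; exact: commut_lie.
  rewrite /flie_tree /= [LHS]flie_lift_br; last exact: commut_lie.
  rewrite -!/(F _) IHx ?IHy // => a av; apply: h; rewrite /= mem_cat av ?orbT //.
pose L : {linear flie R 'I_n -> (seq nat -> R^o)} :=
  HB.pack F (GRing.isLinear.Build _ _ _ _ _ Flin).
have : L (val (\sum_(p <- s) p.1 *: lie_basis n p.2)) = 0 by rewrite s0 !linear0.
rewrite !linear_sum => /(congr1 (fun g => g w)); rewrite fct_sumE => e.
rewrite -[RHS]/((0 : seq nat -> R^o) w) -e big_seq [RHS]big_seq; apply: eq_bigr => p ps.
have vp := allP sv p ps.
have Fp : L (val (lie_basis n p.2)) = coefw R p.2.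
  rewrite -[LHS]/(F (lie_val _)) lie_basisE // Ftree // => a.
  by rewrite (valid_mem _ vp).
by rewrite !linearZ Fp.
Qed.

End LieBasis.

(** * The universal property *)

Section Extension.
Variable R : comPzRingType.

(** A linear map on a basis: the value on x is computed from any expansion of x, and
    two expansions of x differ by a relation, which [lie_basis_free] transports. *)
Lemma lie_basis_extend n (V : lmodType R) (v : tree -> V) :
  exists F : {linear lieMod R n -> V},
    forall t, valid n t -> F (lie_basis R n t) = v t.
Proof.
pose S x := cid2 (@lie_basis_span R n x).
pose f x : V := \sum_(p <- s2val (S x)) p.1 *: v p.2.
have fE x s : all (fun p => valid n p.2) s ->
    x = \sum_(p <- s) p.1 *: lie_basis R n p.2 -> f x = \sum_(p <- s) p.1 *: v p.2.
  move=> sv xE; apply/eqP; rewrite -subr_eq0; apply/eqP.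
  have Sv := s2valP (S x); have SE := s2valP' (S x).
  (* The difference of the two expansions of x, as a relation. *)
  pose s' := s2val (S x) ++ [seq (- p.1, p.2) | p <- s].
  have cat (W : lmodType R) (w : tree -> W) : \sum_(p <- s') p.1 *: w p.2 =
      \sum_(p <- s2val (S x)) p.1 *: w p.2 - \sum_(p <- s) p.1 *: w p.2.
    rewrite big_cat big_map /= -sumrN; congr (_ + _).
    by apply: eq_bigr => p _; rewrite scaleNr.
  rewrite /f -cat; apply: (@lie_basis_free R n).
    by rewrite all_cat Sv all_map.
  by rewrite cat -SE -xE subrr.
have flin : linear f.
  move=> a x y; have Sx := s2valP' (S x); have Sy := s2valP' (S y).
  rewrite (fE _ ([seq (a * p.1, p.2) | p <- s2val (S x)] ++ s2val (S y))).
  - rewrite big_cat big_map /= /f scaler_sumr; congr (_ + _).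
    by apply: eq_bigr => p _; rewrite scalerA.
  - by rewrite all_cat all_map (s2valP (S y)) andbT; exact: (s2valP (S x)).
  - rewrite big_cat big_map /= {1}Sx {1}Sy scaler_sumr; congr (_ + _).
    by apply: eq_bigr => p _; rewrite scalerA.
pose L : {linear lieMod R n -> V} := HB.pack f (GRing.isLinear.Build _ _ _ _ f flin).
exists L => t vt; rewrite -[LHS]/(f _) (fE _ [:: (1, t)]) /= ?vt //.
  by rewrite big_seq1 scale1r.
by rewrite big_seq1 scale1r.
Qed.

Lemma eq_linear_basis n (V : lmodType R) (f g : lieMod R n -> V) :
  linear f -> linear g ->
  (forall t, valid n t -> f (lie_basis R n t) = g (lie_basis R n t)) -> f =1 g.
Proof.
move=> flin glin fg x; have [s /allP sv ->] := lie_basis_span x.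
have sumE h : linear h -> h (\sum_(p <- s) p.1 *: lie_basis R n p.2) =
    \sum_(p <- s) p.1 *: (h (lie_basis R n p.2) : V).
  move=> hlin; pose L : {linear lieMod R n -> V} :=
    HB.pack h (GRing.isLinear.Build _ _ _ _ h hlin).
  rewrite -[LHS]/(L _) linear_sum; apply: eq_bigr => p _; exact: linearZ.
rewrite !sumE // big_seq [RHS]big_seq; apply: eq_bigr => p /sv vp.
by rewrite fg.
Qed.

End Extension.

(** Factorisations with both factors of arity at least 2, so that both arities are
    smaller than k; it lives in Type because its fields are used to compute. *)
Record decomp k t := Decomp {
  d_m : nat; d_n : nat; d_i : nat; d_s : tree; d_u : tree;
  d_splits : splits k t d_m d_n d_i d_s d_u;
  d_m1 : (1 < d_m)%N;
  d_n1 : (1 < d_n)%N }.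

Definition decomp_pick k t : option (decomp k t) :=
  if pselect (exists d : decomp k t, True) is left h then Some (projT1 (cid h))
  else None.

Definition indec k t := valid k t /\ (decomp k t -> False).

Section Gens.
Variables (R : comPzRingType) (n : nat).

Definition gen_span : {pred lieMod R n} :=
  fun x => `[< lspan (fun y => exists2 t, indec n t & y = lie_basis R n t) x >].

Lemma gen_span_submod : submod_closed gen_span.
Proof.
split; first by apply/asboolP; exact: span0.
move=> a x y /asboolP sx /asboolP sy; apply/asboolP.
by apply: spanD => //; apply: spanZ.
Qed.

HB.instance Definition _ :=
  GRing.isSubmodClosed.Build R (lieMod R n) gen_span gen_span_submod.

(** Taking the generators inside Lie(n), rather than as an abstract free module, makes
    the structure map of the universal property the inclusion. *)
Record genMod := GenMod { gen_val :> lieMod R n; gen_valP : gen_val \in gen_span }.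

HB.instance Definition _ := [isSub for gen_val].
HB.instance Definition _ := [Choice of genMod by <:].
HB.instance Definition _ := [SubChoice_isSubLmodule of genMod by <:].

Definition gen_tree t : genMod := insubd 0 (lie_basis R n t).

Lemma gen_treeE t : indec n t -> gen_val (gen_tree t) = lie_basis R n t.
Proof.
by move=> it; apply: insubdK; apply/asboolP; apply: span_in; exists t.
Qed.

End Gens.

Section Universal.
Variables (R : comPzRingType) (O : nsOperad R).
Variable phi : forall n, {linear genMod R n.+2 -> O n.+2}.

Definition tree_base k t : O k :=
  match k with
  | 0 => 0
  | 1 => ns_unit O
  | n.+2 => phi n (gen_tree R n.+2 t)
  end.

(** Evaluation of a tree in O along one chosen factorisation of each decomposable
    tree; N bounds the depth of the recursion, and N = k suffices. *)
Fixpoint tree_ev N k t : O k :=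
  if N is N'.+1 then
    if decomp_pick k t is Some d then
      ns_comp (splits_arity (d_splits d)) (Ordinal (splits_lt (d_splits d)))
        (tree_ev N' (d_m d) (d_s d)) (tree_ev N' (d_n d) (d_u d))
    else tree_base k t
  else 0.

Definition tree_val k t := tree_ev k k t.

Lemma decomp_lt k t (d : decomp k t) : (d_m d < k)%N /\ (d_n d < k)%N.
Proof.
case: d => m n i s u [/= e _ _ _ _] m1 n1; lia.
Qed.

Lemma tree_ev_fuel N N' k t :
  (k <= N)%N -> (k <= N')%N -> tree_ev N k t = tree_ev N' k t.
Proof.
have ev0 M u : tree_ev M 0 u = 0.
  by case: M => //= M; case: decomp_pick => [d|//]; have [] := decomp_lt d.
elim: N N' k t => [|N IH] [|N'] [|k] t kN kN' //; rewrite ?ev0 //=.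
case: decomp_pick => [d|//]; have [ltm ltn] := decomp_lt d.
by congr ns_comp; apply: IH; lia.
Qed.

Lemma tree_val_unit : tree_val 1 (WGen 0) = ns_unit O.
Proof.
rewrite /tree_val /=; case: decomp_pick => [d|//].
by have [] := decomp_lt d; have := d_m1 d; lia.
Qed.

Lemma tree_val_gen n t : indec n.+2 t -> tree_val n.+2 t = phi n (gen_tree R n.+2 t).
Proof.
by case=> _ nd; rewrite /tree_val /=; case: decomp_pick => [d|//]; case: (nd d).
Qed.

Lemma tree_val_dec k t (d : decomp k t) : exists d' : decomp k t,
  tree_val k t = ns_comp (splits_arity (d_splits d')) (Ordinal (splits_lt (d_splits d')))
    (tree_val (d_m d') (d_s d')) (tree_val (d_n d') (d_u d')).
Proof.
have : (0 < k)%N by have [] := decomp_lt d; lia.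
case: k d => // k d _; rewrite /tree_val /= /decomp_pick.
case: pselect => [h|[]]; last by exists d.
exists (projT1 (cid h)); move: (projT1 _) => {}d.
by have [? ?] := decomp_lt d; congr ns_comp; apply: tree_ev_fuel; lia.
Qed.

(** Separated by arity because it is proved by strong induction on k: the two factors
    of a nontrivial composite have smaller arity. *)
Definition comp_ok k := forall m n (e : (m + n)%N = k.+1) (i : 'I_m) s u,
  valid m s -> valid n u ->
  tree_val k (circ i n s u) = ns_comp e i (tree_val m s) (tree_val n u).

Section Diamond.
Variables (k : nat) (t : tree).
Hypothesis IH : forall k', (k' < k)%N -> comp_ok k'.

Definition split_val m n i s u (d : splits k t m n i s u) : O k :=
  ns_comp (splits_arity d) (Ordinal (splits_lt d)) (tree_val m s) (tree_val n u).

(** By induction the values of u and of the other top tree split further, so the two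
    sides are the two bracketings of a triple composite. *)
Lemma split_val_nested m n i s u m' n' i' s' u'
    (d : splits k t m n i s u) (d' : splits k t m' n' i' s' u') :
  (1 < m)%N -> (1 < n')%N -> occ (shift i' u') (shift i u) ->
  split_val d = split_val d'.
Proof.
move=> m1 n'1 /(splits_nested d d')[r [j [w [i'E du ds']]]].
have [e1 j1 vw vu' uE] := du; have [e2 j2 vs _ s'E] := ds'.
have e := splits_arity d; have e' := splits_arity d'.
rewrite /split_val.
have -> : tree_val n u = ns_comp e1 (Ordinal j1) (tree_val r w) (tree_val n' u').
  by rewrite -IH //= -?uE //; lia.
have -> : tree_val m' s' = ns_comp e2 (Ordinal j2) (tree_val m s) (tree_val r w).
  by rewrite -IH //= -?s'E //; lia.
rewrite (ns_comp_seq e2 (splits_arity d') e1 (splits_arity d)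
  (i := Ordinal j2) (j := Ordinal j1)) //.
by congr ns_comp; apply: val_inj.
Qed.

(** By induction the two top trees split off the other block, so the two sides are the
    same pair of compositions performed in the two orders. *)
Lemma split_val_disjoint m n i s u m' n' i' s' u'
    (d : splits k t m n i s u) (d' : splits k t m' n' i' s' u') :
  (1 < n)%N -> (1 < n')%N -> (i + n <= i')%N ->
  split_val d = split_val d'.
Proof.
move=> n1 n'1 /(splits_disjoint d d')[r [j [w [ij i'E ds ds']]]].
have [e1 j1 vw vu' sE] := ds; have [e2 j2 _ vu s'E] := ds'.
have e := splits_arity d; have e' := splits_arity d'.
rewrite /split_val.
have -> : tree_val m s = ns_comp e1 (Ordinal j1) (tree_val r w) (tree_val n' u').
  by rewrite -IH //= -?sE //; lia.
have -> : tree_val m' s' = ns_comp e2 (Ordinal j2) (tree_val r w) (tree_val n u).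
  by rewrite -IH //= -?s'E //; lia.
by rewrite (ns_comp_par e2 (splits_arity d') e1 (splits_arity d) (i := Ordinal j2)
  (j := Ordinal j1) (i' := Ordinal (splits_lt d))).
Qed.

Lemma split_val_eq m n i s u m' n' i' s' u'
    (d : splits k t m n i s u) (d' : splits k t m' n' i' s' u') :
  (1 < m)%N -> (1 < n)%N -> (1 < m')%N -> (1 < n')%N ->
  split_val d = split_val d'.
Proof.
move=> m1 n1 m'1 n'1; case: (splits_cases d d') => h.
- exact: split_val_nested.
- by apply/esym/split_val_nested.
- exact: split_val_disjoint.
- by apply/esym/split_val_disjoint.
Qed.

End Diamond.

Lemma valid1 s : valid 1 s -> s = WGen 0.
Proof.
case: s => [a|x y] vs; first by move: (valid_mem a vs); rewrite inE eqxx; case: a {vs}.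
have := valid_size vs; rewrite /= size_cat.
by have := labels_gt0 x; have := labels_gt0 y; lia.
Qed.

(** Compositions with the unit are trivial; otherwise the given factorisation is
    compared with the chosen one. *)
Lemma tree_val_comp k : comp_ok k.
Proof.
have [N] := ubnP k; elim: N k => [|N IHN] k; first by rewrite ltn0.
rewrite ltnS => kN m n e i s u vs vu.
have IH k' : (k' < k)%N -> comp_ok k' by move=> lt; apply: IHN; exact: leq_trans lt kN.
have [m0 n0] := (valid_gt0 vs, valid_gt0 vu).
have [m1|m1] := eqVneq m 1%N.
  subst m; have nk : n = k by lia.
  subst n; rewrite (valid1 vs) (ord1 i) circ1l tree_val_unit.
  by rewrite ns_comp1l.
have [n1|n1] := eqVneq n 1%N.
  subst n; have mk : m = k by lia.
  subst m; rewrite (valid1 vu) circ1r tree_val_unit.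
  by rewrite ns_comp1r.
have d : splits k (circ i n s u) m n i s u by split.
have [m2 n2] : (1 < m)%N /\ (1 < n)%N by lia.
have [d' ->] := tree_val_dec (Decomp d m2 n2).
rewrite -[LHS]/(split_val (d_splits d')).
rewrite (split_val_eq IH (d_splits d') d (d_m1 d') (d_n1 d') m2 n2) /split_val.
by congr ns_comp; [exact: eq_irrelevance | exact: val_inj].
Qed.

Lemma lie_gen_extend : exists f : nsOperadHom (Lie R) O,
  forall n t, valid n t -> f n (lie_basis R n t) = tree_val n t.
Proof.
pose f n := projT1 (cid (@lie_basis_extend R n (O n) (tree_val n))).
have fE n t : valid n t -> f n (lie_basis R n t) = tree_val n t.
  by move=> vt; exact: projT2 (cid (lie_basis_extend n (tree_val n))) t vt.
have f1 : f 1%N (ns_unit (Lie R)) = ns_unit O.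
  by rewrite /= -lie_basis_unit fE // tree_val_unit.
have fcomp m n k (mnk : (m + n)%N = k.+1) (i : 'I_m) (a : Lie R m) (b : Lie R n) :
    f k (ns_comp mnk i a b) = ns_comp mnk i (f m a) (f n b).
  move: a; apply: eq_linear_basis => [c x y|c x y|s vs].
  - by rewrite ns_comp_linearl linearP.
  - by rewrite linearP ns_comp_linearl.
  move: b; apply: eq_linear_basis => [c x y|c x y|u vu].
  - by rewrite ns_comp_linearr linearP.
  - by rewrite linearP ns_comp_linearr.
  rewrite /= lie_basis_comp // !fE //; last exact: valid_circ vs vu.
  exact: tree_val_comp.
by exists (NsOperadHom f1 fcomp).
Qed.

Lemma lie_gen_unique (g : nsOperadHom (Lie R) O) :
  (forall n x, g n.+2 (gen_val x) = phi n x) ->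
  forall n t, valid n t -> g n (lie_basis R n t) = tree_val n t.
Proof.
move=> gphi n; have [N] := ubnP n; elim: N n => [|N IH] n; first by rewrite ltn0.
rewrite ltnS => nN t vt.
have [[d _]|nd] := pselect (exists d : decomp n t, True).
  have [ltm ltn] := decomp_lt d.
  case: d ltm ltn => m k i s u [e im vs vu tE] m1 k1 /= ltm ltk.
  rewrite tE (tree_val_comp e (Ordinal im)) // -(lie_basis_comp R e (Ordinal im)) //.
  rewrite [LHS](ns_hom_comp g) !IH //; exact: leq_trans nN.
case: n nN t vt nd => [|[|n]] nN t vt nd.
- by have := valid_gt0 vt.
- by rewrite (valid1 vt) lie_basis_unit tree_val_unit -(ns_hom_unit g).
- have it : indec n.+2 t by split=> // d; apply: nd; exists d.
  by rewrite tree_val_gen // -gphi gen_treeE.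
Qed.

End Universal.

Theorem theorem1 (R : comPzRingType) :
  exists (X : nat -> lmodType R) (F : nsOperad R)
    (iota : forall n : nat, {linear X n.+2 -> F n.+2}),
    is_free_nsOperad X F iota /\ nsOperad_iso (Lie R) F.
Proof.
pose idH := @NsOperadHom R (Lie R) (Lie R) (fun n => idfun) erefl
  (fun _ _ _ _ _ _ _ => erefl).
exists (fun n => genMod R n), (Lie R),
  (fun n => val : {linear genMod R n.+2 -> lieMod R n.+2}).
split; last by exists idH, idH.
move=> O phi; have [f fE] := lie_gen_extend phi; exists f; split=> [n x|g gphi n x].
  have := asboolP _ (gen_valP x); move xE: (gen_val x) => y sy.
  elim: sy x xE => [|a _ z [t it ->] sz IH] x xE.
    have -> : x = 0 by apply: val_inj; rewrite /= xE.
    by rewrite !linear0.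
  pose z' := GenMod (introT (asboolP _) sz).
  have -> : x = a *: gen_tree R n.+2 t + z'.
    by apply: val_inj; rewrite linearP /= gen_treeE.
  rewrite !linearP /= gen_treeE // (IH z') // fE ?tree_val_gen //.
  by case: it.
apply: eq_linear_basis x => [a x y|a x y|t vt]; rewrite ?linearP //.
by rewrite fE // (lie_gen_unique gphi).
Qed.
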